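(* Under (ER) the sequence $\{\mathbb{G}^{(N)}(\mathcal{F})\}$ converges almost surely (in $\ell^\infty(\mathcal{F})$), as $N\to+\infty$, to the centered Gaussian process $\mathbb{G}^{(\infty)}(\mathcal{F})$ defined by $$\mathbb{G}^{(\infty)}(f)=\mathbb{G}(f)-S_{1,\text{even}}(f)^t\cdot\mathbb{G}[\mathcal{A}]-S_{2,\text{odd}}(f)^t\cdot\mathbb{G}[\mathcal{B}],\quad f\in\mathcal{F}.$$ Moreover, for all $N$ large and some $c_3>0$ depending on $\lambda_1,\lambda_2,P(\mathcal{A}),P(\mathcal{B})$, $$d_{LP}(\mathbb{G}^{(N)},\mathbb{G}^{(\infty)})\leqslant c_3\sqrt N\,\max(\lambda_1,\lambda_2)^{N/2}.$$
   Context: $P$ is a probability measure on a measurable space $\mathcal{X}$, $P(f)=\int f\,dP$. $\mathcal{A}=\{A_1,\dots,A_{m_1}\}$ and $\mathcal{B}=\{B_1,\dots,B_{m_2}\}$ are two different finite measurable partitions of $\mathcal{X}$, $m_1,m_2\geqslant2$, all of whose sets have positive $P$-probability; $P(\mathcal{A})=(P(A_1),\dots,P(A_{m_1}))$, $P(\mathcal{B})=(P(B_1),\dots,P(B_{m_2}))$. They are raked alternately: $\mathcal{A}^{(2m+1)}=\mathcal{A}$ for $m\geqslant0$ and $\mathcal{A}^{(2m)}=\mathcal{B}$ for $m\geqslant1$. $\mathcal{F}$ is a class of measurable real functions, uniformly bounded by $M<\infty$, pointwise measurable (each $f\in\mathcal{F}$ is a pointwise limit of a sequence from a fixed countable subset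 of $\mathcal{F}$), containing $1_D$ and $1_Df$ for $f\in\mathcal{F}$, $D\in\mathcal{A}\cup\mathcal{B}$, and satisfying one of the following entropy conditions, with $d_Q^2(f,g)=\int(f-g)^2dQ$: (VC) for some $c_0,\nu_0>0$ the minimal number of $d_Q$-balls of radius $\varepsilon$ covering $\mathcal{F}$ is at most $c_0/\varepsilon^{\nu_0}$ for all $0<\varepsilon<1$ and all discrete probability measures $Q$; (BR) for some $b_0>0,r_0\in(0,1)$ the minimal number of brackets $\{f:g_-\leqslant f\leqslant g_+\}$ with $d_P(g_-,g_+)<\varepsilon$ covering $\mathcal{F}$ is at most $\exp(b_0^2/\varepsilon^{2r_0})$ for $0<\varepsilon<1$. $\mathbb{G}=\mathbb{G}^{(0)}$ is the $P$-Brownian bridge indexed by $\mathcal{F}$ (with sample paths in $\ell^\infty(\mathcal{F})$): centered Gaussian, linear in $f$, $\mathrm{Cov}(\mathbb{G}(f),\mathbb{G}(g))=P(fg)-P(f)P(g)$; $\mathbb{G}^{(N)}(D)=\mathbb{G}^{(N)}(1_D)$, $\mathbb{E}(f|D)=P(f1_D)/P(D)$. For $N\geqslant1$, writing $\mathcal{A}^{(N)}=\{A_j^{(N)}\}$, $$\mathbb{G}^{(N)}(f)=\mathbb{G}^{(N-1)}(f)-\sum_j\mathbb{E}(f|A_j^{(N)})\,\mathbb{G}^{(N-1)}(A_j^{(N)}).$$ Notation: column vectors $\mathbb{G}[\mathcal{A}]=(\mathbb{G}(A_i))_{i}$, $\mathbb{G}[\mathcal{B}]=(\mathbb{G}(B_j))_{j}$,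 $\mathbb{E}[f|\mathcal{A}]=(\mathbb{E}(f|A_i))_i$, $\mathbb{E}[f|\mathcal{B}]=(\mathbb{E}(f|B_j))_j$; stochastic matrices $(\mathbf{P}_{\mathcal{A}|\mathcal{B}})_{i,j}=P(A_j|B_i)$ ($m_2\times m_1$) and $(\mathbf{P}_{\mathcal{B}|\mathcal{A}})_{i,j}=P(B_j|A_i)$ ($m_1\times m_2$). (ER): the stochastic matrices $\mathbf{P}_{\mathcal{A}|\mathcal{B}}\mathbf{P}_{\mathcal{B}|\mathcal{A}}$ and $\mathbf{P}_{\mathcal{B}|\mathcal{A}}\mathbf{P}_{\mathcal{A}|\mathcal{B}}$ are ergodic (irreducible and aperiodic). For $N\geqslant0$, $$S_{1,\text{even}}^{(N)}(f)=\sum_{k=0}^N(\mathbf{P}_{\mathcal{B}|\mathcal{A}}\mathbf{P}_{\mathcal{A}|\mathcal{B}})^k\cdot(\mathbb{E}[f|\mathcal{A}]-\mathbf{P}_{\mathcal{B}|\mathcal{A}}\cdot\mathbb{E}[f|\mathcal{B}]),\quad S_{2,\text{odd}}^{(N)}(f)=\sum_{k=0}^N(\mathbf{P}_{\mathcal{A}|\mathcal{B}}\mathbf{P}_{\mathcal{B}|\mathcal{A}})^k\cdot(\mathbb{E}[f|\mathcal{B}]-\mathbf{P}_{\mathcal{A}|\mathcal{B}}\cdot\mathbb{E}[f|\mathcal{A}]),$$ $$S_{1,\text{odd}}^{(N)}(f)=S_{1,\text{even}}^{(N)}(f)+(\mathbf{P}_{\mathcal{B}|\mathcal{A}}\mathbf{P}_{\mathcal{A}|\mathcal{B}})^{N+1}\cdot\mathbb{E}[f|\mathcal{A}],\quad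 S_{2,\text{even}}^{(N)}(f)=S_{2,\text{odd}}^{(N)}(f)+(\mathbf{P}_{\mathcal{A}|\mathcal{B}}\mathbf{P}_{\mathcal{B}|\mathcal{A}})^{N+1}\cdot\mathbb{E}[f|\mathcal{B}].$$ Under (ER) these converge uniformly on $\mathcal{F}$ as $N\to\infty$, with limits denoted $S_{l,\text{even}}(f)$, $S_{l,\text{odd}}(f)$, $l=1,2$; and $\lambda_1,\lambda_2\in(0,1)$ are numbers such that, for some $c_1,c_2>0$ and all $N$, $\sup_{f\in\mathcal{F}}\|S_{l,\ast}^{(N)}(f)-S_{l,\ast}(f)\|\leqslant c_l\lambda_l^N$ for $l=1,2$ and $\ast\in\{\text{even},\text{odd}\}$ (supremum norm on $\mathbb{R}^{m_l}$). $\ell^\infty(\mathcal{F})$: bounded real functions on $\mathcal{F}$ with the supremum norm. $d_{LP}(X,Y)$ is the Lévy-Prokhorov distance between the laws of $X,Y$ on $\ell^\infty(\mathcal{F})$: the infimum of $\varepsilon>0$ such that $\mathbb{P}(X\in D)\leqslant\mathbb{P}(Y\in D^\varepsilon)+\varepsilon$ and $\mathbb{P}(Y\in D)\leqslant\mathbb{P}(X\in D^\varepsilon)+\varepsilon$ for all Borel $D$, with $D^\varepsilon$ the $\varepsilon$-neighbourhood of $D$.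
   Formalization: The constant c_3 is allowed to depend also on the uniform bound M of the class F, besides λ_1, λ_2, P(A), P(B); rescaling functions of F shows that no constant independent of M can work. *)

(* Defs.v *)
From HB Require Import structures.
From mathcomp Require Import all_boot all_order all_algebra.
From mathcomp Require Import all_classical all_reals all_analysis.

Set Implicit Arguments.
Unset Strict Implicit.
Unset Printing Implicit Defensive.

Import Order.TTheory GRing.Theory Num.Theory.
Import numFieldNormedType.Exports.

Local Open Scope classical_set_scope.
Local Open Scope ring_scope.

Section bounded_functions.
Context {T : Type} {R : realType}.

Definition bounded_pred : {pred T -> R} :=
  [pred z : T -> R | `[< exists K, forall t, `|z t| <= K >]].

Lemma bounded_predP (z : T -> R) :
  reflect (exists K, forall t, `|z t| <= K) (z \in bounded_pred).
Proof. by rewrite inE; exact: asboolP. Qed.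

Lemma bounded_pred_submod_closed : submod_closed bounded_pred.
Proof.
split.
  by apply/bounded_predP; exists 0 => t; rewrite normr0.
move=> a x y /bounded_predP[K xK] /bounded_predP[L yL].
apply/bounded_predP; exists (`|a| * K + L) => t.
rewrite (le_trans (ler_normD _ _))// lerD// normrM.
by rewrite ler_wpM2l.
Qed.

HB.instance Definition _ := GRing.isSubmodClosed.Build _ _ bounded_pred
  bounded_pred_submod_closed.

End bounded_functions.

Record linf (R : realType) (T : Type) := Linf {
  linf_fun :> T -> R ;
  linf_funP : linf_fun \in bounded_pred }.

Section linf_normed.
Variables (R : realType) (T : Type).

HB.instance Definition _ := [isSub for @linf_fun R T].
HB.instance Definition _ := gen_eqMixin (linf R T).
HB.instance Definition _ := gen_choiceMixin (linf R T).
HB.instance Definition _ := [SubChoice_isSubLmodule of linf R T by <:].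

Definition linf_norm (z : linf R T) : R := sup (range (fun t => `|z t|)).

Let ubP (z : linf R T) : has_ubound (range (fun t => `|z t|)).
Proof.
by have /bounded_predP[K zK] := linf_funP z; exists K => _ [t _ <-].
Qed.

Lemma linf_norm_ub (z : linf R T) t : `|z t| <= linf_norm z.
Proof. by apply: ub_le_sup; [exact: ubP | exists t]. Qed.

Lemma linf_norm_ge0 (z : linf R T) : 0 <= linf_norm z.
Proof.
rewrite /linf_norm; have [[x [t tT tx]]|] := pselect (range (fun t => `|z t|) !=set0).
  by apply: le_trans (linf_norm_ub z t).
by move=> /set0P/negP; rewrite negbK => /eqP ->; rewrite sup0.
Qed.

Lemma linf_norm_le (z : linf R T) (K : R) :
  0 <= K -> (forall t, `|z t| <= K) -> linf_norm z <= K.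
Proof.
move=> K0 zK; rewrite /linf_norm.
have [ne|] := pselect (range (fun t => `|z t|) !=set0).
  by apply: ge_sup => // _ [t _ <-].
by move=> /set0P/negP; rewrite negbK => /eqP ->; rewrite sup0.
Qed.

Let ler_linf_normD (x y : linf R T) :
  linf_norm (x + y) <= linf_norm x + linf_norm y.
Proof.
apply: linf_norm_le => [|t]; first by rewrite addr_ge0// linf_norm_ge0.
by rewrite (le_trans (ler_normD _ _))// lerD// linf_norm_ub.
Qed.

Let linf_normZ (l : R) (x : linf R T) :
  linf_norm (l *: x) = `|l| * linf_norm x.
Proof.
have le a (y : linf R T) : linf_norm (a *: y) <= `|a| * linf_norm y.
  apply: linf_norm_le => [|t]; first by rewrite mulr_ge0// linf_norm_ge0.
  by rewrite normrM ler_wpM2l// linf_norm_ub.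
apply/eqP; rewrite eq_le le /=.
have [->|l0] := eqVneq l 0; first by rewrite normr0 mul0r linf_norm_ge0.
rewrite -ler_pdivlMl ?normr_gt0// -normfV.
by rewrite (le_trans _ (le _ _))// scalerA mulVf// scale1r.
Qed.

Let linf_norm0_eq0 (x : linf R T) : linf_norm x = 0 -> x = 0.
Proof.
move=> x0; apply/val_inj/funext => t /=.
by apply/eqP; rewrite -normr_le0 -x0; exact: linf_norm_ub.
Qed.

HB.instance Definition _ := Lmodule_isNormed.Build R (linf R T)
  ler_linf_normD linf_normZ linf_norm0_eq0.

End linf_normed.

Section levy_prokhorov.
Context {R : realType} {T : Type} {d : measure_display}
  {Omega : measurableType d}.
Variable Pr : probability Omega R.

Definition linf_borel : set (set (linf R T)) :=
  <<s [set U : set (linf R T) | open U] >>.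

Definition enlarge (D : set (linf R T)) (eps : R) : set (linf R T) :=
  [set z | exists2 y, D y & `|z - y| < eps].

(* The law of [Y] is taken as the outer probability of the events [Y \in D], so
   that no Borel measurability of the path map into the (in general
   non-separable) space l^oo has to be assumed; it is the usual law as soon as
   these events are measurable, see [linf_lawE]. *)
Definition linf_law (Y : Omega -> linf R T) (D : set (linf R T)) : \bar R :=
  mu_ext Pr (Y @^-1` D).

Lemma linf_lawE (Y : Omega -> linf R T) D :
  measurable (Y @^-1` D) -> linf_law Y D = Pr (Y @^-1` D).
Proof. by move=> mYD; rewrite /linf_law measurable_mu_extE. Qed.

Definition dLP (Y Z : Omega -> linf R T) : R :=
  inf [set eps : R | 0 < eps /\
    forall D, linf_borel D ->
      (linf_law Y D <= linf_law Z (enlarge D eps) + eps%:E)%E /\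
      (linf_law Z D <= linf_law Y (enlarge D eps) + eps%:E)%E].

End levy_prokhorov.

Section gaussian.
Context {R : realType} {d : measure_display} {Omega : measurableType d}.
Variable Pr : probability Omega R.

(* [normal_prob m 0] is not a point mass in the library. *)
Definition normal_law (m s : R) (U : set R) : \bar R :=
  if s == 0 then \d_m U else normal_prob m s U.

Definition gaussian_rv (Y : Omega -> R) : Prop :=
  measurable_fun setT Y /\
  exists m s : R, 0 <= s /\
    forall U : set R, measurable U -> Pr (Y @^-1` U) = normal_law m s U.

(* A process indexed by [F] is a map on the ambient type [I] of indices; only
   its values at indices in [F] matter. *)
Definition gaussian_process (I : Type) (F : set I) (Z : Omega -> I -> R) :=
  forall (n : nat) (f : 'I_n -> I) (a : 'I_n -> R), (forall k, F (f k)) ->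
    gaussian_rv (fun w => \sum_(k < n) a k * Z w (f k)).

Definition centered_gaussian_process (I : Type) (F : set I)
    (Z : Omega -> I -> R) :=
  gaussian_process F Z /\
  forall f, F f -> ('E_Pr[fun w => Z w f] = 0)%E.

End gaussian.

Section ergodic.
Context {R : realType} {n : nat}.
Implicit Type T : 'M[R]_n.

Definition irreducible_mx T :=
  forall i j, exists2 k : nat, (0 < k)%N & 0 < (T ^+ k) i j.

(* The gcd of the return times to every state is 1. *)
Definition aperiodic_mx T :=
  forall i (p : nat),
    (forall k : nat, (0 < k)%N -> 0 < (T ^+ k) i i -> (p %| k)%N) -> p = 1%N.

Definition ergodic_mx T := irreducible_mx T /\ aperiodic_mx T.

End ergodic.

Section raking.
Context {R : realType} {d : measure_display} {X : measurableType d}.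
Implicit Types (P Q : probability X R) (F : set (X -> R)) (f g : X -> R).

Definition sqdist Q f g : \bar R := (\int[Q]_x ((f x - g x) ^+ 2)%:E)%E.

Definition discrete_probability Q : Prop :=
  exists (x : nat -> X) (p : nat -> R), (forall k, 0 <= p k) /\
    forall D, measurable D ->
      Q D = (\sum_(0 <= k <oo) (p k)%:E * \d_(x k) D)%E.

(* The distance is below [eps] iff its square is below [eps ^+ 2]; the centers
   of the balls need not lie in [F]. *)
Definition covering_number Q F (eps : R) : \bar R :=
  ereal_inf [set (n%:R)%:E | n in [set n : nat |
    exists2 c : 'I_n -> (X -> R), (forall k, measurable_fun setT (c k)) &
      forall f, F f -> exists k, (sqdist Q (c k) f < (eps ^+ 2)%:E)%E]].

Definition bracketing_number P F (eps : R) : \bar R :=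
  ereal_inf [set (n%:R)%:E | n in [set n : nat |
    exists l u : 'I_n -> (X -> R),
      (forall k, [/\ measurable_fun setT (l k), measurable_fun setT (u k) &
                     (sqdist P (l k) (u k) < (eps ^+ 2)%:E)%E]) /\
      forall f, F f -> exists k, forall x, l k x <= f x <= u k x]].

Definition VC_entropy F : Prop :=
  exists c0 nu0 : R, [/\ 0 < c0, 0 < nu0 &
    forall (eps : R) Q, 0 < eps < 1 -> discrete_probability Q ->
      (covering_number Q F eps <= (c0 / eps `^ nu0)%:E)%E].

Definition BR_entropy P F : Prop :=
  exists b0 r0 : R, [/\ 0 < b0, 0 < r0 < 1 &
    forall eps : R, 0 < eps < 1 ->
      (bracketing_number P F eps
         <= (expR (b0 ^+ 2 / eps `^ (2 * r0)))%:E)%E].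

Definition pointwise_measurable F : Prop :=
  exists F0 : set (X -> R), [/\ countable F0, F0 `<=` F &
    forall f, F f -> exists u : nat -> X -> R,
      (forall n, F0 (u n)) /\ forall x, u n x @[n --> \oo] --> f x].

Definition stable_under (m : nat) (D : 'I_m -> set X) F : Prop :=
  forall i, F \1_(D i) /\ forall f, F f -> F (\1_(D i) \* f).

Record admissible_class P (m1 m2 : nat) (A : 'I_m1 -> set X)
    (B : 'I_m2 -> set X) (M : R) F : Prop := {
  class_measurable : forall f, F f -> measurable_fun setT f ;
  class_bounded : forall f, F f -> forall x, `|f x| <= M ;
  class_pointwise_measurable : pointwise_measurable F ;
  class_stableA : stable_under A F ;
  class_stableB : stable_under B F ;
  class_entropy : VC_entropy F \/ BR_entropy P F }.

Definition positive_partition P (m : nat) (D : 'I_m -> set X) : Prop :=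
  [/\ forall i, measurable (D i), trivIset setT D, \bigcup_i D i = setT &
      forall i, (0 < P (D i))%E].

Definition prob_vec P (m : nat) (D : 'I_m -> set X) : 'cV[R]_m :=
  \col_i fine (P (D i)).

Definition cexp P f (D : set X) : R :=
  (\int[P]_x (f x * \1_D x)) / fine (P D).

Definition cexp_vec P (m : nat) (D : 'I_m -> set X) f : 'cV[R]_m :=
  \col_i cexp P f (D i).

(* [cond_mx P D C] is the matrix P_{C|D}, with entries P(C_j|D_i). *)
Definition cond_mx P (m n : nat) (D : 'I_m -> set X) (C : 'I_n -> set X) :
    'M[R]_(m, n) :=
  \matrix_(i, j) (fine (P (C j `&` D i)) / fine (P (D i))).

Definition eval_vec (z : (X -> R) -> R) (m : nat) (D : 'I_m -> set X) :
    'cV[R]_m :=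
  \col_i z \1_(D i).

Section processes.
Context {d' : measure_display} {Omega : measurableType d'}.
Variable Pr : probability Omega R.

Definition bounded_path F (z : (X -> R) -> R) : Prop :=
  exists K, forall f, F f -> `|z f| <= K.

Definition linear_path F (z : (X -> R) -> R) : Prop :=
  forall (a b : R) f g, F f -> F g -> F (fun x => a * f x + b * g x) ->
    z (fun x => a * f x + b * g x) = a * z f + b * z g.

Record brownian_bridge P F (G : Omega -> (X -> R) -> R) : Prop := {
  bridge_gaussian : centered_gaussian_process Pr F G ;
  bridge_cov : forall f g, F f -> F g ->
    covariance Pr (fun w => G w f) (fun w => G w g) =
    (\int[P]_x (f x * g x) - (\int[P]_x f x) * (\int[P]_x g x))%:E ;
  bridge_linear : {ae Pr, forall w, linear_path F (G w)} ;
  bridge_bounded : forall w, bounded_path F (G w) }.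

End processes.

Definition rake_step P (m : nat) (D : 'I_m -> set X) (z : (X -> R) -> R) :
    (X -> R) -> R :=
  fun f => z f - \sum_j cexp P f (D j) * z \1_(D j).

Fixpoint raked P (m1 m2 : nat) (A : 'I_m1 -> set X) (B : 'I_m2 -> set X)
    (N : nat) (z : (X -> R) -> R) : (X -> R) -> R :=
  if N is N'.+1 then
    if odd N then rake_step P A (raked P A B N' z)
    else rake_step P B (raked P A B N' z)
  else z.

Section limit_sums.
Variables (P : probability X R) (m1 m2 : nat).
Variables (A : 'I_m1 -> set X) (B : 'I_m2 -> set X).

Let PAB : 'M[R]_(m2, m1) := cond_mx P B A.
Let PBA : 'M[R]_(m1, m2) := cond_mx P A B.
Let EA := cexp_vec P A.
Let EB := cexp_vec P B.

Definition ER : Prop := ergodic_mx (PAB *m PBA) /\ ergodic_mx (PBA *m PAB).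

Definition S1even_sum (N : nat) f : 'cV[R]_m1 :=
  \sum_(k < N.+1) (PBA *m PAB) ^+ k *m (EA f - PBA *m EB f).

Definition S2odd_sum (N : nat) f : 'cV[R]_m2 :=
  \sum_(k < N.+1) (PAB *m PBA) ^+ k *m (EB f - PAB *m EA f).

Definition S1odd_sum (N : nat) f : 'cV[R]_m1 :=
  S1even_sum N f + (PBA *m PAB) ^+ N.+1 *m EA f.

Definition S2even_sum (N : nat) f : 'cV[R]_m2 :=
  S2odd_sum N f + (PAB *m PBA) ^+ N.+1 *m EB f.

Definition S1even f : 'cV[R]_m1 := lim (S1even_sum N f @[N --> \oo]).
Definition S2odd f : 'cV[R]_m2 := lim (S2odd_sum N f @[N --> \oo]).
Definition S1odd f : 'cV[R]_m1 := lim (S1odd_sum N f @[N --> \oo]).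
Definition S2even f : 'cV[R]_m2 := lim (S2even_sum N f @[N --> \oo]).

(* The norm on column vectors is the supremum norm. *)
Definition geometric_rate F (m : nat) (Sn : nat -> (X -> R) -> 'cV[R]_m)
    (S : (X -> R) -> 'cV[R]_m) (c lambda : R) : Prop :=
  forall N f, F f -> `|Sn N f - S f| <= c * lambda ^+ N.

Definition convergence_rates F (lambda1 lambda2 : R) : Prop :=
  exists c1 c2 : R, [/\ 0 < c1, 0 < c2,
    geometric_rate F S1even_sum S1even c1 lambda1 /\
    geometric_rate F S1odd_sum S1odd c1 lambda1 &
    geometric_rate F S2even_sum S2even c2 lambda2 /\
    geometric_rate F S2odd_sum S2odd c2 lambda2].

Definition raked_limit (z : (X -> R) -> R) : (X -> R) -> R := fun f =>
  z f - ((S1even f)^T *m eval_vec z A) 0 0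
      - ((S2odd f)^T *m eval_vec z B) 0 0.

End limit_sums.

End raking.

(* Main.v *)
Require Import Defs.
From HB Require Import structures.
From mathcomp Require Import all_boot all_order all_algebra.
From mathcomp Require Import all_classical all_reals all_analysis.
From mathcomp Require Import measurable_realfun ring lra.

Set Implicit Arguments.
Unset Strict Implicit.
Unset Printing Implicit Defensive.

Import Order.TTheory GRing.Theory Num.Theory.
Import numFieldNormedType.Exports.

Local Open Scope classical_set_scope.
Local Open Scope ring_scope.

(* Write [TB] for the stochastic matrix [P_{A|B} P_{B|A}]. Raking only acts on the
   vectors [G[A]] and [G[B]]; computing it explicitly gives, with
   [b1 = G[B] - P_{B|A}^T G[A]],
     G^(2m+1)(f) = G(f) - E[f|A]^T G[A]
                   - (sum_(k < m) TB^k (E[f|B] - P_{A|B} E[f|A]))^T b1,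
     G^(2m+2)(f) = G^(2m+1)(f) - (TB^m E[f|B])^T b1.
   The entries of [G[A]] and of [G[B]] sum to 0 almost surely (the sums have
   variance 0), so [E[f|B]] may be centered, and everything reduces to the decay
   of [TB^k x] for [x] of P-mean zero. Under (ER) a power of [TB] is positive,
   hence contracts such vectors by a fixed factor (Doeblin). For the rate, the
   constant may not depend on the [c_l]: since [TB] is self-adjoint in the
   L^2 space weighted by P(B), the squared norms of [l^-k TB^k x] form a convex
   sequence, which decreases as soon as it is bounded; so the rate [l] holds with
   a constant depending only on P(B) and M. The Gaussian tail of the maximum of
   [|G(A_i)|, |G(B_j)|] at level of order [sqrt N] then bounds the
   Levy-Prokhorov distance. *)

(** * Powers of a matrix acting on columns *)

Lemma mulmx_exprS {R : pzRingType} {n : nat} (T : 'M[R]_n) (x : 'cV[R]_n) k :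
  T ^+ k.+1 *m x = T *m (T ^+ k *m x).
Proof. by rewrite exprS -mulmxE mulmxA. Qed.

Lemma mulmx_exprD {R : pzRingType} {n : nat} (T : 'M[R]_n) (x : 'cV[R]_n) j k :
  T ^+ (j + k) *m x = T ^+ j *m (T ^+ k *m x).
Proof. by rewrite exprD -mulmxE mulmxA. Qed.

Lemma mulmx_expr_scale {R : comPzRingType} {n : nat} (a : R) (T : 'M[R]_n)
    (x : 'cV[R]_n) k : (a *: T) ^+ k *m x = a ^+ k *: (T ^+ k *m x).
Proof.
elim: k => [|k IH]; first by rewrite !expr0 scale1r.
by rewrite !mulmx_exprS IH -scalemxAl -scalemxAr scalerA -exprS.
Qed.

(** * Convex sequences and reversible matrices *)

(** Convexity makes the increments nondecreasing, so one positive increment would force at least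
    linear growth from there on, past any bound [C]. *)
Lemma convex_seq_bounded_nonincreasing {R : realType} (u : nat -> R) (C : R) :
  (forall k, 2 * u k.+1 <= u k + u k.+2) -> (forall k, u k <= C) ->
  forall k, u k.+1 <= u k.
Proof.
move=> cu uC k; rewrite leNgt; apply/negP => lt.
have step j : u k.+1 - u k <= u (k + j).+1 - u (k + j)%N.
  elim: j => [|j IH]; first by rewrite addn0.
  by rewrite addnS; have := cu (k + j)%N; lra.
have lin j : u k + j%:R * (u k.+1 - u k) <= u (k + j)%N.
  elim: j => [|j IH]; first by rewrite mul0r addr0 addn0.
  by rewrite addnS -natr1 mulrDl mul1r; have := step j; lra.
have d0 : 0 < u k.+1 - u k by lra.
pose j := (Num.truncn ((C - u k) / (u k.+1 - u k))).+1.
have /lt_le_trans : (C - u k) / (u k.+1 - u k) < j%:R by exact: truncnS_gt.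
have := lin j; have := uC (k + j)%N.
move=> h1 h2 /(_ _ (lexx _)); rewrite ltr_pdivrMr//; lra.
Qed.

Section reversible.
Context {R : realType} {n : nat}.
Variables (p : 'I_n -> R) (T : 'M[R]_n).
Hypothesis p0 : forall i, 0 < p i.
Hypothesis pT : forall i j, p i * T i j = p j * T j i.

Let dot (x y : 'cV[R]_n) := \sum_i p i * (x i 0 * y i 0).

(** Detailed balance is self-adjointness for the inner product weighted by [p]. *)
Let dot_adj x y : dot (T *m x) y = dot x (T *m y).
Proof.
rewrite /dot.
transitivity (\sum_i \sum_j p i * T i j * x j 0 * y i 0).
  apply: eq_bigr => i _; rewrite mxE mulr_suml mulr_sumr.
  by apply: eq_bigr => j _; ring.
rewrite exchange_big; apply: eq_bigr => j _.
rewrite mxE !mulr_sumr; apply: eq_bigr => i _; rewrite pT; ring.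
Qed.

(* Reversibility makes the squared norms of [T ^+ k *m v] a convex sequence. *)
Lemma reversible_bounded_contract (v : 'cV[R]_n) (c : R) :
  (forall k i, `|(T ^+ k *m v) i 0| <= c) ->
  forall k, \sum_i p i * (T ^+ k *m v) i 0 ^+ 2 <= \sum_i p i * v i 0 ^+ 2.
Proof.
move=> bv.
pose u k := dot (T ^+ k *m v) (T ^+ k *m v).
have uE k : \sum_i p i * (T ^+ k *m v) i 0 ^+ 2 = u k.
  by apply: eq_bigr => i _; rewrite expr2.
have u0E : \sum_i p i * v i 0 ^+ 2 = u 0%N.
  by rewrite -uE expr0; apply: eq_bigr => i _; rewrite -[in LHS](mul1mx v).
have cu k : 2 * u k.+1 <= u k + u k.+2.
  (* Moving one factor [T] across the inner product turns a squared norm into a product of the two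
     neighbouring iterates; convexity is then [2ab <= a^2 + b^2]. *)
  have -> : u k.+1 = dot (T ^+ k *m v) (T ^+ k.+2 *m v).
    by rewrite /u {1}mulmx_exprS dot_adj -mulmx_exprS.
  rewrite -subr_ge0 /u /dot mulr_sumr -big_split /= -sumrB sumr_ge0// => i _.
  set a := (T ^+ k *m v) i 0; set b := (T ^+ k.+2 *m v) i 0.
  have -> : p i * (a * a) + p i * (b * b) - 2 * (p i * (a * b)) =
    p i * (a - b) ^+ 2 by ring.
  by rewrite mulr_ge0 ?sqr_ge0// ltW.
have uC k : u k <= \sum_i p i * c ^+ 2.
  rewrite -uE; apply: ler_sum => i _.
  rewrite ler_wpM2l ?(ltW (p0 i))// -(real_normK (num_real _)) lerXn2r ?nnegrE//.
  by rewrite (le_trans _ (bv k i)).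
move=> k; rewrite uE u0E; elim: k => // k IH.
exact: le_trans (convex_seq_bounded_nonincreasing cu uC k) IH.
Qed.

End reversible.

(* The constant depends on [p] only, not on [c]. *)
Lemma reversible_geometric {R : realType} {n : nat} (p : 'I_n -> R)
    (T : 'M[R]_n) (v : 'cV[R]_n) (c l b : R) :
  (forall i, 0 < p i) -> (forall i j, p i * T i j = p j * T j i) ->
  0 < l -> \sum_i p i = 1 ->
  (forall k i, `|(T ^+ k *m v) i 0| <= c * l ^+ k) ->
  (forall i, `|v i 0| <= b) ->
  forall k i, `|(T ^+ k *m v) i 0| <= (\sum_j (p j)^-1) * b * l ^+ k.
Proof.
move=> p0 pT l0 p1 bv vb k i; set K := \sum_j (p j)^-1.
(* Rescaling [T] by [l^-1] keeps detailed balance and turns geometric decay into mere boundedness of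
   the orbit; the bound [c] is forgotten after that. *)
have pTl i' j : p i' * (l^-1 *: T) i' j = p j * (l^-1 *: T) j i'.
  by rewrite !mxE mulrCA pT mulrCA.
have b0 : 0 <= b by exact: (le_trans (normr_ge0 _) (vb i)).
have vc k' i' : `|((l^-1 *: T) ^+ k' *m v) i' 0| <= c.
  rewrite mulmx_expr_scale mxE normrM normrX normfV (gtr0_norm l0) exprVn.
  by rewrite ler_pdivrMl ?exprn_gt0// mulrC.
have := reversible_bounded_contract p0 pTl vc k.
have -> : \sum_i p i * ((l^-1 *: T) ^+ k *m v) i 0 ^+ 2 =
    (l^-1 ^+ k) ^+ 2 * \sum_i p i * (T ^+ k *m v) i 0 ^+ 2.
  rewrite mulr_sumr; apply: eq_bigr => j _.
  by rewrite mulmx_expr_scale mxE exprMn mulrCA.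
rewrite !exprVn ler_pdivrMl ?exprn_gt0// => H.
have pinv j : 1 <= (p j)^-1.
  rewrite -[1]invr1 lef_pV2 ?posrE// -p1 (bigD1 j)//= lerDl.
  by apply: sumr_ge0 => ? _; exact: ltW.
(* Going from the weighted squared norm to a single entry costs [(p i)^-1], which is at most [K],
   hence at most [K ^+ 2] because [1 <= K]. *)
have Ki : (p i)^-1 <= K.
  rewrite /K (bigD1 i)//= lerDl; apply: sumr_ge0 => j _.
  by rewrite invr_ge0 ltW.
have K1 : 1 <= K := le_trans (pinv i) Ki.
have Kb0 : 0 <= K * b * l ^+ k by rewrite !mulr_ge0 ?exprn_ge0//; lra.
have vb2 : \sum_i p i * v i 0 ^+ 2 <= b ^+ 2.
  rewrite -[leRHS]mul1r -p1 mulr_suml; apply: ler_sum => j _.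
  rewrite ler_wpM2l ?(ltW (p0 j))// -(real_normK (num_real _)) lerXn2r ?nnegrE//.
have : p i * (T ^+ k *m v) i 0 ^+ 2 <= (l ^+ k) ^+ 2 * b ^+ 2.
  apply: le_trans (le_trans H _); last by rewrite ler_wpM2l// sqr_ge0.
  rewrite (bigD1 i)//= lerDl; apply: sumr_ge0 => j _.
  by rewrite mulr_ge0 ?sqr_ge0// ltW.
rewrite -ler_pdivlMl// => H2.
rewrite -(ler_pXn2r (n := 2)) ?nnegrE// real_normK ?num_real//.
apply: le_trans H2 _.
have -> : (K * b * l ^+ k) ^+ 2 = K ^+ 2 * ((l ^+ k) ^+ 2 * b ^+ 2) by ring.
rewrite ler_wpM2r ?mulr_ge0 ?exprn_ge0 ?(ltW l0)//.
by apply: le_trans Ki _; rewrite expr2 ler_peMl//; lra.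
Qed.

(** * Stochastic matrices and geometric ergodicity *)

Definition stochastic_mx {R : realType} {m n : nat} (T : 'M[R]_(m, n)) :=
  (forall i j, 0 <= T i j) /\ forall i, \sum_j T i j = 1.

Lemma stochastic_mx_mul {R : realType} {m n q : nat} (S : 'M[R]_(m, n))
    (T : 'M[R]_(n, q)) :
  stochastic_mx S -> stochastic_mx T -> stochastic_mx (S *m T).
Proof.
move=> [S0 S1] [T0 T1]; split=> [i j|i].
  by rewrite mxE sumr_ge0// => ? _; rewrite mulr_ge0.
under eq_bigr do rewrite mxE.
rewrite exchange_big /= -(S1 i); apply: eq_bigr => j _.
by rewrite -mulr_sumr T1 mulr1.
Qed.

Lemma stochastic_mulmx_le {R : realType} {m n : nat} (T : 'M[R]_(m, n))
    (x : 'cV[R]_n) b :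
  stochastic_mx T ->
  (forall i, `|x i 0| <= b) -> forall i, `|(T *m x) i 0| <= b.
Proof.
move=> [T0 T1] xb i; rewrite mxE (le_trans (ler_norm_sum _ _ _))//.
rewrite -[b]mul1r -(T1 i) mulr_suml; apply: ler_sum => j _.
by rewrite normrM ger0_norm// ler_wpM2l.
Qed.

Lemma stochastic_mulmx_const {R : realType} {m n : nat} (T : 'M[R]_(m, n))
    (a : R) : stochastic_mx T -> T *m const_mx a = const_mx a :> 'cV_m.
Proof.
move=> [_ T1]; apply/colP => i; rewrite !mxE.
under eq_bigr do rewrite mxE.
by rewrite -mulr_suml T1 mul1r.
Qed.

Section stochastic.
Context {R : realType} {n : nat}.
Implicit Types S T : 'M[R]_n.


Lemma stochastic_mx_expr T k : stochastic_mx T -> stochastic_mx (T ^+ k).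
Proof.
move=> [T0 T1]; elim: k => [|k [I0 I1]].
  split=> [i j|i]; first by rewrite expr0 mxE; case: (_ == _).
  rewrite (bigD1 i)//= big1 ?addr0 ?mxE ?eqxx// => j /negPf ji.
  by rewrite mxE eq_sym ji.
by rewrite exprS -mulmxE; exact: stochastic_mx_mul.
Qed.

Lemma stochastic_expr_mulmx_le T (x : 'cV[R]_n) b k : stochastic_mx T ->
  (forall i, `|x i 0| <= b) -> forall i, `|(T ^+ k *m x) i 0| <= b.
Proof. by move=> sT; apply: stochastic_mulmx_le; exact: stochastic_mx_expr. Qed.

(* Subtracting [d] times the rank one matrix of rows [p] does not change the
   action on the vectors of [p]-mean zero. *)
Lemma doeblin_contract (p : 'I_n -> R) S (x : 'cV[R]_n) (d b : R) :
  \sum_i p i = 1 -> \sum_i p i * x i 0 = 0 -> stochastic_mx S ->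
  (forall i j, d * p j <= S i j) -> (forall i, `|x i 0| <= b) ->
  forall i, `|(S *m x) i 0| <= (1 - d) * b.
Proof.
move=> p1 px [S0 S1] Sd xb i.
have -> : (S *m x) i 0 = \sum_j (S i j - d * p j) * x j 0.
  under eq_bigr do rewrite mulrBl -mulrA.
  by rewrite sumrB -mulr_sumr px mulr0 subr0 mxE.
have -> : 1 - d = \sum_j (S i j - d * p j).
  by rewrite sumrB S1 -mulr_sumr p1 mulr1.
rewrite (le_trans (ler_norm_sum _ _ _))// mulr_suml; apply: ler_sum => j _.
by rewrite normrM ger0_norm ?subr_ge0// ler_wpM2l ?subr_ge0.
Qed.

(** A positive diagonal allows waiting in place: once [j] is reached from [i], it is reached at all
    later times. The sum of the chosen hitting times over all pairs is therefore late enough for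
    every pair. *)
Lemma irreducible_primitive T : stochastic_mx T -> irreducible_mx T ->
  (forall i, 0 < T i i) ->
  exists2 K : nat, (0 < K)%N & forall i j, 0 < (T ^+ K) i j.
Proof.
move=> sT irr Td.
have diag i k : 0 < (T ^+ k) i i.
  elim: k => [|k IH]; first by rewrite expr0 mxE eqxx.
  rewrite exprS -mulmxE mxE (bigD1 i)//= ltr_pwDl ?mulr_gt0//.
  rewrite sumr_ge0// => j _; rewrite mulr_ge0 ?(proj1 sT)//.
  exact: (stochastic_mx_expr k sT).1.
have [k kP] : {k : 'I_n -> 'I_n -> nat & forall i j, 0 < (T ^+ k i j) i j}.
  apply: (@choice _ _ (fun i (k : 'I_n -> nat) => forall j, 0 < (T ^+ k j) i j)) => i.
  have [j|f fP] := @choice _ _ (fun j k => 0 < (T ^+ k) i j).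
    by have [k _ ?] := irr i j; exists k.
  by exists f.
exists (\sum_i \sum_j k i j).+1 => // i j.
have kle : (k i j <= (\sum_i \sum_j k i j).+1)%N.
  by rewrite leqW// (bigD1 i)//= (bigD1 j)//= -addnA leq_addr.
rewrite -(subnKC kle) exprD -mulmxE mxE (bigD1 j)//= ltr_pwDl ?mulr_gt0//.
rewrite sumr_ge0// => l _; rewrite mulr_ge0//.
  exact: (stochastic_mx_expr _ sT).1.
exact: (stochastic_mx_expr _ sT).1.
Qed.

Lemma stationary_mulmx (p : 'I_n -> R) T (x : 'cV[R]_n) :
  (forall j, \sum_i p i * T i j = p j) ->
  \sum_i p i * (T *m x) i 0 = \sum_i p i * x i 0.
Proof.
move=> pT; under eq_bigr do rewrite mxE mulr_sumr.
rewrite exchange_big; apply: eq_bigr => j _ /=.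
by rewrite -pT mulr_suml; apply: eq_bigr => i _; rewrite mulrA.
Qed.

Lemma bernoulli_ineq (t : R) k : 0 <= t <= 1 -> 1 - k%:R * t <= (1 - t) ^+ k.
Proof.
move=> /andP[t0 t1]; elim: k => [|k IH]; first by rewrite mul0r subr0 expr0.
rewrite exprS -natr1.
apply: (@le_trans _ _ ((1 - t) * (1 - k%:R * t))).
  have : 0 <= k%:R * t ^+ 2 by rewrite mulr_ge0// sqr_ge0.
  set q := k%:R; rewrite -subr_ge0 => h; rewrite -subr_ge0.
  by apply: le_trans h _; rewrite le_eqVlt; apply/orP; left; apply/eqP; ring.
by rewrite ler_wpM2l// subr_ge0.
Qed.

(** A positive power [T ^+ K] satisfies the Doeblin condition, so each block of [K] steps contracts
    by [1 - d], and the steps left over do not increase the supremum norm. Stationarity of [p] keeps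
    the iterates of mean zero from block to block. *)
Lemma stochastic_geometric (p : 'I_n -> R) T :
  (forall i, 0 <= p i) -> \sum_i p i = 1 ->
  (forall j, \sum_i p i * T i j = p j) ->
  stochastic_mx T -> irreducible_mx T -> (forall i, 0 < T i i) ->
  exists rho C : R, [/\ 0 < rho < 1, 0 < C &
    forall (x : 'cV[R]_n) b, \sum_i p i * x i 0 = 0 ->
      (forall i, `|x i 0| <= b) ->
      forall k i, `|(T ^+ k *m x) i 0| <= C * b * rho ^+ k].
Proof.
move=> p0 p1 pT sT irr Td.
have [K K0 TK] := irreducible_primitive sT irr Td.
have p_le1 j : p j <= 1.
  by rewrite -p1 (bigD1 j)//= lerDl sumr_ge0.
have [d /andP[d0 d1] dP] : exists2 d : R, 0 < d < 1 & forall i j, d * p j <= (T ^+ K) i j.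
  pose s := \sum_i \sum_j ((T ^+ K) i j)^-1.
  have t0 i j : 0 <= ((T ^+ K) i j)^-1 by rewrite invr_ge0 ltW.
  have s0 : 0 <= s by apply: sumr_ge0 => i _; exact: sumr_ge0.
  (* The inverse of every entry is at most [s], so every entry is at least [(2 + s)^-1]; the [2]
     keeps this number below 1. *)
  exists (2 + s)^-1.
    by rewrite invr_gt0 invf_lt1; lra.
  move=> i j; apply: (@le_trans _ _ (2 + s)^-1).
    by rewrite ler_piMr// invr_ge0; lra.
  rewrite -[leRHS]invrK lef_pV2 ?posrE ?invr_gt0//; last lra.
  apply: (@le_trans _ _ s); last lra.
  rewrite /s (bigD1 i)//= (bigD1 j)//= -addrA lerDl addr_ge0 ?sumr_ge0//.
  by move=> *; exact: sumr_ge0.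
have KR : (0 : R) < K%:R by rewrite ltr0n.
have K1 : (1 : R) <= K%:R by rewrite ler1n.
(* By Bernoulli's inequality [1 - d <= rho ^+ K], which spreads the contraction of a block over its
   [K] steps. *)
pose rho := 1 - d / K%:R.
have dK : 0 < d / K%:R < 1.
  by rewrite divr_gt0// ltr_pdivrMr// mul1r (lt_le_trans d1).
have r0 : 0 < rho by rewrite /rho; lra.
(* The factor [rho ^- K] compensates for the incomplete last block of [k %% K] steps. *)
exists rho, (rho ^- K); split; [by rewrite /rho; lra| by rewrite invr_gt0 exprn_gt0|].
move=> x b px xb k i.
have b0 : 0 <= b by exact: (le_trans (normr_ge0 _) (xb i)).
have px' l : \sum_i p i * (T ^+ l *m x) i 0 = 0.
  by elim: l => [|l IH]; rewrite ?expr0 ?mul1mx// mulmx_exprS stationary_mulmx.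
have block q : forall j, `|(T ^+ (K * q) *m x) j 0| <= (1 - d) ^+ q * b.
  elim: q => [|q IH] j; first by rewrite muln0 !expr0 mul1mx mul1r.
  rewrite mulnS mulmx_exprD exprS -mulrA.
  exact: (doeblin_contract p1 (px' _) (stochastic_mx_expr K sT) dP IH).
rewrite (divn_eq k K) addnC mulnC mulmx_exprD.
apply: le_trans (stochastic_expr_mulmx_le _ sT (block _) _) _.
apply: (@le_trans _ _ (rho ^+ (K * (k %/ K)) * b)).
  rewrite ler_wpM2r// exprM lerXn2r ?nnegrE ?exprn_ge0 ?(ltW r0)//; first lra.
  have := @bernoulli_ineq (d / K%:R) K.
  rewrite [_ * (_ / _)]mulrC divfK ?gt_eqF// => ->//.
  by lra.
rewrite exprD.
have -> : rho ^- K * b * (rho ^+ (k %% K) * rho ^+ (K * (k %/ K))) =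
  rho ^- K * rho ^+ (k %% K) * (rho ^+ (K * (k %/ K)) * b) by ring.
rewrite ler_peMl ?mulr_ge0 ?exprn_ge0 ?(ltW r0)//.
rewrite ler_pdivlMl ?exprn_gt0// mulr1.
by rewrite ler_wiXn2l ?(ltW r0)//; [rewrite /rho; lra|rewrite ltnW// ltn_pmod].
Qed.
End stochastic.

(** * Series with geometrically small terms *)

(** With [t m] the geometric tail, [s m - t m] increases and [s m + t m] decreases; the supremum of
    the former lies between the two for every [m]. *)
Lemma geometric_tail {R : realType} (w : nat -> R) (c rho : R) :
  0 < rho < 1 -> (forall k, `|w k| <= c * rho ^+ k) ->
  exists L, forall m, `|L - \sum_(k < m) w k| <= c * rho ^+ m / (1 - rho).
Proof.
move=> /andP[r0 r1] wb.
pose s m := \sum_(k < m) w k; pose t m := c * rho ^+ m / (1 - rho).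
have r1' : 1 - rho != 0 by lra.
have tS m : t m = c * rho ^+ m + t m.+1.
  by rewrite /t exprS; field.
have t0 m : 0 <= t m.
  rewrite /t divr_ge0 ?(le_trans _ (wb m))//; lra.
have lo : {homo (fun m => s m - t m) : m n / (m <= n)%N >-> m <= n}.
  apply: homo_leq => // [? ? ?|m]; first exact: le_trans.
  rewrite /s big_ord_recr /= (tS m).
  by have := wb m; rewrite ler_norml => /andP[]; lra.
have up : {homo (fun m => s m + t m) : m n / (m <= n)%N >-> n <= m}.
  apply: homo_leq => // [? ? ? /[swap]|m]; first exact: le_trans.
  rewrite /s big_ord_recr /= (tS m).
  by have := wb m; rewrite ler_norml => /andP[]; lra.
have lu m n : s m - t m <= s n + t n.
  apply: le_trans (lo _ _ (leq_maxl m n)) _.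
  apply: le_trans _ (up _ _ (leq_maxr m n)).
  by have := t0 (maxn m n); lra.
exists (sup (range (fun m => s m - t m))) => m.
rewrite ler_norml; apply/andP; split.
  suff : s m - t m <= sup (range (fun m => s m - t m)) by rewrite /s /t; lra.
  apply: ub_le_sup; last by exists m.
  by exists (s 0%N + t 0%N) => _ [n _ <-].
suff : sup (range (fun m => s m - t m)) <= s m + t m by rewrite /s /t; lra.
apply: ge_sup; first by exists (s 0%N - t 0%N); exists 0%N.
by move=> _ [n _ <-].
Qed.

Lemma cV_norm_le {R : realType} {n : nat} (x : 'cV[R]_n) b :
  0 <= b -> (forall i, `|x i 0| <= b) -> `|x| <= b.
Proof.
move=> b0 xb; rewrite -[`|x|]/(mx_norm x) mx_normrE.
by apply/bigmax_leP; split => // -[i j] _; rewrite ord1.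
Qed.

Lemma cV_norm_ge {R : realType} {n : nat} (x : 'cV[R]_n) i : `|x i 0| <= `|x|.
Proof.
rewrite -[leRHS]/(mx_norm x) mx_normrE.
exact: (le_bigmax 0 (fun ij : 'I_n * 'I_1 => `|x ij.1 ij.2|) (i, 0)).
Qed.

Lemma cvg_geometric_cV {R : realType} {n : nat} (u : nat -> 'cV[R]_n)
    (L : 'cV[R]_n) (c rho : R) : 0 < rho < 1 -> 0 <= c ->
  (forall N i, `|(u N - L) i 0| <= c * rho ^+ N) -> u N @[N --> \oo] --> L.
Proof.
move=> /andP[r0 r1] c0 uL.
apply/cvgrPdist_le => e e0.
have : c * rho ^+ N @[N --> \oo] --> (0 : R).
  by apply: cvg_geometric; rewrite gtr0_norm.
move=> /cvgr0_norm_le /(_ _ e0); apply: filterS => N.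
rewrite ger0_norm ?mulr_ge0 ?exprn_ge0 ?(ltW r0)// => ce.
rewrite distrC; apply: cV_norm_le (ltW e0) _ => i.
exact: le_trans (uL N i) ce.
Qed.

(** Shows that the [lim] in the definitions of the limit sums is a genuine limit, with an entrywise
    bound on the remainder. *)
Lemma geometric_series_cV {R : realType} {n : nat} (w : nat -> 'cV[R]_n)
    (c rho : R) : 0 < rho < 1 -> 0 <= c ->
  (forall k i, `|w k i 0| <= c * rho ^+ k) ->
  let L := lim (\sum_(k < N.+1) w k @[N --> \oo]) in
  \sum_(k < N.+1) w k @[N --> \oo] --> L /\
  forall m i, `|(L - \sum_(k < m) w k) i 0| <= c / (1 - rho) * rho ^+ m.
Proof.
move=> r01 c0 wb L.
have [l lP] := choice (fun i => geometric_tail r01 (fun k => wb k i)).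
have tail m i : `|(\col_i l i - \sum_(k < m) w k) i 0| <= c / (1 - rho) * rho ^+ m.
  by rewrite mulrAC !mxE summxE.
have cl : \sum_(k < N.+1) w k @[N --> \oo] --> \col_i l i.
  apply: (@cvg_geometric_cV _ _ _ _ (c / (1 - rho)) rho) => //.
    by rewrite divr_ge0//; lra.
  move=> N i; rewrite -opprB mxE normrN (le_trans (tail _ _))//.
  rewrite ler_wpM2l ?divr_ge0//; first by lra.
  by rewrite ler_wiXn2l//; lra.
have LE : L = \col_i l i by exact: (cvg_lim _ cl).
by rewrite LE.
Qed.

(** * Finite partitions: conditional expectations and transition matrices *)

Section partitions.
Context {R : realType} {d : measure_display} {X : measurableType d}.
Variable P : probability X R.

Lemma bounded_integrable (f : X -> R) (M : R) :
  measurable_fun setT f -> (forall x, `|f x| <= M) ->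
  P.-integrable setT (EFin \o f).
Proof.
move=> mf fM; apply: measurable_bounded_integrable => //.
  by rewrite -ge0_fin_numE// fin_num_measure.
exists M; split; first by rewrite num_real.
by move=> x Mx y _; exact: le_trans (fM y) (ltW Mx).
Qed.

Lemma integrable_mul_indic (f : X -> R) (M : R) (D : set X) :
  measurable_fun setT f -> (forall x, `|f x| <= M) -> measurable D ->
  P.-integrable setT (fun x => (f x * \1_D x)%:E).
Proof.
move=> mf fM mD; apply: (@bounded_integrable _ M).
  by apply: measurable_funM => //; exact: measurable_indic.
move=> x; rewrite normrM (le_trans _ (fM x))// ler_piMr//.
by rewrite indicE; case: (_ \in _); rewrite ?normr1 ?normr0.
Qed.

Lemma Rintegral_indic (D : set X) : measurable D ->
  \int[P]_x \1_D x = fine (P D).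
Proof. by move=> mD; rewrite /Rintegral integral_indic// setIT. Qed.

Section one_partition.
Variables (m : nat) (D : 'I_m -> set X).
Hypothesis hD : positive_partition P D.

Lemma partition_gt0 i : 0 < fine (P (D i)).
Proof.
have [_ _ _ /(_ i) h] := hD.
by rewrite fine_gt0// h -ge0_fin_numE// fin_num_measure//; case: hD.
Qed.

Lemma partition_indic_sum x : \sum_i \1_(D i) x = 1 :> R.
Proof.
have [_ tD cD _] := hD.
have [i _ Dix] : (\bigcup_i D i) x by rewrite cD.
rewrite (bigD1 i)//= big1 ?addr0; first by rewrite indicE mem_set.
move=> j ji; rewrite indicE memNset// => Djx.
move/trivIsetP : tD => /(_ i j I I); rewrite eq_sym ji => /(_ erefl).
by move/seteqP => [/(_ x)] /(_ (conj Dix Djx)).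
Qed.

Lemma Rintegral_partition (f : X -> R) (M : R) :
  measurable_fun setT f -> (forall x, `|f x| <= M) ->
  \sum_i \int[P]_x (f x * \1_(D i) x) = \int[P]_x f x.
Proof.
move=> mf fM; have [mD _ _ _] := hD.
have inti i : P.-integrable setT (fun x => (f x * \1_(D i) x)%:E).
  exact: integrable_mul_indic fM (mD i).
rewrite /Rintegral sum_fine => [|i _]; last exact: integrable_fin_num.
rewrite -integral_sum//; congr fine; apply: eq_integral => x _.
by rewrite sumEFin -mulr_sumr partition_indic_sum mulr1.
Qed.

Lemma cexp_bounded (f : X -> R) (M : R) i :
  measurable_fun setT f -> (forall x, `|f x| <= M) -> `|cexp P f (D i)| <= M.
Proof.
move=> mf fM; have [mD _ _ _] := hD.
rewrite /cexp normrM normfV (gtr0_norm (partition_gt0 i)).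
rewrite ler_pdivrMr ?partition_gt0// -Rintegral_indic//.
have iD : P.-integrable setT (EFin \o (\1_(D i) : X -> R)).
  apply: (@bounded_integrable _ 1); first exact: measurable_indic.
  by move=> x; rewrite indicE; case: (_ \in _); rewrite ?normr1 ?normr0.
rewrite -RintegralZl//.
apply: le_trans (le_normr_Rintegral _ _) _ => //.
  exact: integrable_mul_indic fM (mD i).
apply: le_Rintegral => //.
- exact: integrable_abse (integrable_mul_indic mf fM (mD i)).
- apply: (@integrable_mul_indic (fun=> M) `|M|) => //; exact: measurable_cst.
- move=> x _; rewrite normrM ler_pM//.
  by rewrite indicE; case: (_ \in _); rewrite ?normr1 ?normr0.
Qed.

Lemma cexp_mean (f : X -> R) (M : R) :
  measurable_fun setT f -> (forall x, `|f x| <= M) ->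
  \sum_i fine (P (D i)) * cexp P f (D i) = \int[P]_x f x.
Proof.
move=> mf fM; rewrite -(Rintegral_partition mf fM); apply: eq_bigr => i _.
by rewrite /cexp mulrC divfK// gt_eqF// partition_gt0.
Qed.

Lemma cexp_indic (C : set X) i : measurable C ->
  cexp P \1_C (D i) = fine (P (C `&` D i)) / fine (P (D i)).
Proof.
move=> mC; have [mD _ _ _] := hD.
rewrite /cexp -(@Rintegral_indic (C `&` D i)); last exact: measurableI.
by congr (_ / _); apply: eq_Rintegral => x _; rewrite indicI.
Qed.

Lemma cexp_vec_indic_self i :
  cexp_vec P D \1_(D i) = \col_j (j == i)%:R.
Proof.
have [mD tD _ _] := hD.
apply/colP => j; rewrite !mxE cexp_indic//.
have [->|ji] := eqVneq j i; first by rewrite setIid divff// gt_eqF// partition_gt0.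
move/trivIsetP : tD => /(_ i j I I); rewrite eq_sym ji => /(_ erefl) ->.
by rewrite measure0 mul0r.
Qed.

Lemma partition_measure_sum (C : set X) : measurable C ->
  \sum_i fine (P (C `&` D i)) = fine (P C).
Proof.
move=> mC; have [mD _ _ _] := hD.
rewrite -Rintegral_indic// -(@Rintegral_partition _ 1).
- apply: eq_bigr => i _; rewrite -Rintegral_indic; last exact: measurableI.
  by apply: eq_Rintegral => x _; rewrite indicI.
- exact: measurable_indic.
- by move=> x; rewrite indicE; case: (_ \in _); rewrite ?normr1 ?normr0.
Qed.

Lemma partition_prob_sum : \sum_i fine (P (D i)) = 1.
Proof.
rewrite -[1]/(fine 1%E) -(probability_setT P) -(@partition_measure_sum setT)//.
by apply: eq_bigr => i _; rewrite setTI.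
Qed.

End one_partition.

Section two_partitions.
Variables (m n : nat) (D : 'I_m -> set X) (C : 'I_n -> set X).
Hypotheses (hD : positive_partition P D) (hC : positive_partition P C).

Lemma cond_mx_stochastic : stochastic_mx (cond_mx P D C).
Proof.
have [mD _ _ _] := hD; split=> [i j|i].
  by rewrite mxE divr_ge0 ?fine_ge0.
under eq_bigr do rewrite mxE setIC.
by rewrite -mulr_suml (partition_measure_sum hC)// divff// gt_eqF// partition_gt0.
Qed.

(** The law of total probability: averaging [P(C_j | D_i)] over [D] gives [P(C_j)]. *)
Lemma cond_mx_mean (x : 'cV[R]_n) :
  \sum_i fine (P (D i)) * (cond_mx P D C *m x) i 0 =
  \sum_j fine (P (C j)) * x j 0.
Proof.
have [mC _ _ _] := hC.
under eq_bigr do rewrite mxE mulr_sumr.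
rewrite exchange_big; apply: eq_bigr => j _ /=.
rewrite -(partition_measure_sum hD)// mulr_suml; apply: eq_bigr => i _.
by rewrite mxE mulrA [_ * (_ / _)]mulrC divfK// gt_eqF// partition_gt0.
Qed.

Let T := cond_mx P D C *m cond_mx P C D.

(** Both sides equal the sum over [k] of [P(D_i C_k) P(D_j C_k) / P(C_k)], which is symmetric in [i]
    and [j]. *)
Lemma cond_mx2_reversible i j :
  fine (P (D i)) * T i j = fine (P (D j)) * T j i.
Proof.
have e l (a : R) : fine (P (D l)) * a / fine (P (D l)) = a.
  by rewrite mulrAC divff ?mul1r// gt_eqF// partition_gt0.
rewrite !mxE !mulr_sumr; apply: eq_bigr => k _; rewrite !mxE !mulrA !e.
by rewrite (setIC (D j)) (setIC (D i)); congr (_ / _); rewrite mulrC.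
Qed.

(** The set [D i] meets some [C k] in positive probability, and the chain can go to that [C k] and
    come back. *)
Lemma cond_mx2_diag_gt0 i : 0 < T i i.
Proof.
have [mD _ _ _] := hD; have [mC _ _ _] := hC.
have t0 k : 0 <= cond_mx P D C i k * cond_mx P C D k i.
  by rewrite !mxE mulr_ge0 ?divr_ge0 ?fine_ge0.
rewrite lt_neqAle mxE sumr_ge0 ?andbT// eq_sym psumr_neq0//; apply/hasP.
have : 0 < \sum_k fine (P (D i `&` C k)).
  by rewrite (partition_measure_sum hC)// partition_gt0.
rewrite lt0r psumr_neq0 => [|k _]; last by rewrite fine_ge0.
move=> /andP[/hasP[k kin /= k0] _]; exists k => //=.
by rewrite !mxE mulr_gt0 ?divr_gt0 ?partition_gt0// setIC.
Qed.

End two_partitions.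

Lemma cond_mx2_stochastic (m n : nat) (D : 'I_m -> set X) (C : 'I_n -> set X) :
  positive_partition P D -> positive_partition P C ->
  stochastic_mx (cond_mx P D C *m cond_mx P C D).
Proof. by move=> hD hC; apply: stochastic_mx_mul; exact: cond_mx_stochastic. Qed.

End partitions.

(** * Scalar products of columns *)

Section column_dot.
Context {R : realType} {n : nat}.
Implicit Types x y b : 'cV[R]_n.

Lemma col_dotDl x y b : ((x + y)^T *m b) 0 0 = (x^T *m b) 0 0 + (y^T *m b) 0 0.
Proof. by rewrite linearD mulmxDl mxE. Qed.

Lemma col_dotNl x b : ((- x)^T *m b) 0 0 = - (x^T *m b) 0 0.
Proof. by rewrite linearN mulNmx mxE. Qed.

Lemma col_dotBl x y b : ((x - y)^T *m b) 0 0 = (x^T *m b) 0 0 - (y^T *m b) 0 0.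
Proof. by rewrite col_dotDl col_dotNl. Qed.

Lemma col_dotNr x b : (b^T *m (- x)) 0 0 = - (b^T *m x) 0 0.
Proof. by rewrite mulmxN mxE. Qed.

Lemma col_dotBr x y b : (b^T *m (x - y)) 0 0 = (b^T *m x) 0 0 - (b^T *m y) 0 0.
Proof. by rewrite mulmxBr [LHS]mxE [X in _ + X]mxE. Qed.

Lemma col_dot0l b : ((0 : 'cV[R]_n)^T *m b) 0 0 = 0.
Proof. by rewrite linear0 mul0mx mxE. Qed.

Lemma col_dot_norm_le x b (c : R) : (forall i, `|x i 0| <= c) ->
  `|(x^T *m b) 0 0| <= c * \sum_i `|b i 0|.
Proof.
move=> xc; rewrite mxE (le_trans (ler_norm_sum _ _ _))// mulr_sumr.
by apply: ler_sum => i _; rewrite mxE normrM ler_wpM2r.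
Qed.

End column_dot.

(** * Closed formulas for the raked process *)

Section raking_formula.
Context {R : realType} {d : measure_display} {X : measurableType d}.
Variables (P : probability X R) (m1 m2 : nat).
Variables (A : 'I_m1 -> set X) (B : 'I_m2 -> set X).
Hypotheses (hA : positive_partition P A) (hB : positive_partition P B).

Let PAB : 'M[R]_(m2, m1) := cond_mx P B A.
Let PBA : 'M[R]_(m1, m2) := cond_mx P A B.
Let TB := PAB *m PBA.
Let EA := cexp_vec P A.
Let EB := cexp_vec P B.
Implicit Types (z : (X -> R) -> R) (f : X -> R).

Lemma rake_stepE n (D : 'I_n -> set X) z f :
  rake_step P D z f = z f - ((cexp_vec P D f)^T *m eval_vec z D) 0 0.
Proof.
by rewrite /rake_step mxE; congr (_ - _); apply: eq_bigr => j _; rewrite !mxE.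
Qed.

Lemma eval_vec_rake_self n (D : 'I_n -> set X) z : positive_partition P D ->
  eval_vec (rake_step P D z) D = 0.
Proof.
move=> hD; apply/colP => i; rewrite !mxE rake_stepE cexp_vec_indic_self// mxE.
rewrite (bigD1 i)//= big1 ?addr0 => [|j /negPf ji]; last first.
  by rewrite !mxE ji mul0r.
by rewrite !mxE eqxx mul1r subrr.
Qed.

Lemma eval_vec_rake n k (D : 'I_n -> set X) (C : 'I_k -> set X) z :
  positive_partition P D -> (forall j, measurable (C j)) ->
  eval_vec (rake_step P D z) C = eval_vec z C - (cond_mx P D C)^T *m eval_vec z D.
Proof.
move=> hD mC; apply/colP => j; rewrite !mxE rake_stepE; congr (_ - _).
by rewrite !mxE; apply: eq_bigr => i _; rewrite !mxE cexp_indic.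
Qed.

Lemma raked1 z : raked P A B 1 z = rake_step P A z.
Proof. by []. Qed.

Lemma raked_even z m :
  raked P A B m.*2.+2 z = rake_step P B (raked P A B m.*2.+1 z).
Proof. by rewrite /= odd_double. Qed.

Lemma raked_odd z m :
  raked P A B m.*2.+3 z = rake_step P A (raked P A B m.*2.+2 z).
Proof. by rewrite /= odd_double. Qed.

(** The vector [G^(1)[B]], denoted [b1] above: what the first raking on [A] leaves on the sets of
    [B]. *)
Definition raked_once z : 'cV[R]_m2 := eval_vec z B - PBA^T *m eval_vec z A.

(** Raking on one partition annihilates its own values and sends minus their transposed image to the
    other partition. Over a round, [B] then [A], the two signs cancel and the values on [B] are
    multiplied by the transpose of [TB]. *)
Lemma eval_raked_odd z m :
  eval_vec (raked P A B m.*2.+1 z) A = 0 /\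
  eval_vec (raked P A B m.*2.+1 z) B = (TB ^+ m)^T *m raked_once z.
Proof.
have [mA _ _ _] := hA; have [mB _ _ _] := hB.
elim: m => [|m [IHa IHb]].
  by rewrite raked1 eval_vec_rake_self// eval_vec_rake// expr0 trmx1 mul1mx.
rewrite doubleS raked_odd eval_vec_rake_self//; split=> //.
rewrite eval_vec_rake// raked_even eval_vec_rake_self// sub0r.
rewrite eval_vec_rake// IHa IHb sub0r mulmxN opprK.
by rewrite exprSr -mulmxE trmx_mul /TB trmx_mul !mulmxA.
Qed.

Lemma raked_evenE z f m :
  raked P A B m.*2.+2 z f = raked P A B m.*2.+1 z f
   - ((TB ^+ m *m EB f)^T *m raked_once z) 0 0.
Proof.
have [_ e] := eval_raked_odd z m.
by rewrite raked_even rake_stepE e trmx_mul mulmxA.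
Qed.

(** In each round, raking on [B] subtracts the term in [TB ^+ m *m EB f]; raking on [A] then acts on
    the values just sent to [A], which supplies the term in [PAB *m EA f] with the opposite sign. *)
Lemma raked_oddE z f m :
  raked P A B m.*2.+1 z f = z f - ((EA f)^T *m eval_vec z A) 0 0
    - ((\sum_(k < m) TB ^+ k *m (EB f - PAB *m EA f))^T *m raked_once z) 0 0.
Proof.
elim: m => [|m IH].
  by rewrite raked1 rake_stepE big_ord0 col_dot0l subr0.
have [mA _ _ _] := hA; have [mB _ _ _] := hB.
rewrite doubleS raked_odd rake_stepE {2}raked_even eval_vec_rake//.
have [-> ->] := eval_raked_odd z m.
rewrite raked_evenE IH sub0r.
rewrite big_ord_recr /= col_dotDl (mulmxBr (TB ^+ m)) col_dotBl col_dotNr.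
rewrite !trmx_mul !mulmxA; ring.
Qed.

End raking_formula.

(** * The limit sums under (ER) *)

Section raking_limit.
Context {R : realType} {d : measure_display} {X : measurableType d}.
Variables (P : probability X R) (m1 m2 : nat).
Variables (A : 'I_m1 -> set X) (B : 'I_m2 -> set X).
Hypotheses (hA : positive_partition P A) (hB : positive_partition P B).

Let PAB : 'M[R]_(m2, m1) := cond_mx P B A.
Let PBA : 'M[R]_(m1, m2) := cond_mx P A B.
Let TB := PAB *m PBA.
Let TA := PBA *m PAB.
Let EA := cexp_vec P A.
Let EB := cexp_vec P B.
Let vB f := EB f - PAB *m EA f.
Let pB i := fine (P (B i)).
Let mu f : R := \int[P]_x f x.
Let eB f := EB f - const_mx (mu f).

Lemma cond_mx2_stationary j : \sum_i pB i * TB i j = pB j.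
Proof.
under eq_bigr do rewrite (cond_mx2_reversible A hB).
rewrite -mulr_sumr (cond_mx2_stochastic hB hA).2.
by rewrite mulr1.
Qed.

(** [PBA] intertwines the two chains, so that the decay for [TA] can be read off from the decay for
    [TB]. *)
Lemma mulmx_cond_expr k (x : 'cV[R]_m2) :
  PBA *m (TB ^+ k *m x) = TA ^+ k *m (PBA *m x).
Proof.
elim: k => [|k IH]; first by rewrite !expr0 !mul1mx.
by rewrite !mulmx_exprS -IH !mulmxA.
Qed.

Lemma ER_geometric : ER P A B ->
  exists rho C : R, [/\ 0 < rho < 1, 0 < C &
    forall (x : 'cV[R]_m2) b, \sum_i pB i * x i 0 = 0 ->
      (forall i, `|x i 0| <= b) ->
      forall k i, `|(TB ^+ k *m x) i 0| <= C * b * rho ^+ k].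
Proof.
move=> [[irr _] _]; apply: stochastic_geometric => //.
- by move=> i; rewrite ltW// partition_gt0.
- exact: partition_prob_sum hB.
- exact: cond_mx2_stationary.
- exact: cond_mx2_stochastic hB hA.
- exact: cond_mx2_diag_gt0 hB hA.
Qed.

Section one_function.
Variables (f : X -> R) (M : R).
Hypotheses (mf : measurable_fun setT f) (fM : forall x, `|f x| <= M).

Let M0 : 0 <= M.
Proof.
rewrite leNgt; apply/negP => M_lt0.
have := partition_prob_sum hB; rewrite big1 => [/esym/eqP|i _].
  by rewrite oner_eq0.
have := le_trans (normr_ge0 _) (cexp_bounded hB i mf fM).
by rewrite leNgt M_lt0.
Qed.

Let EA_le i : `|EA f i 0| <= M.
Proof. by rewrite mxE; exact: (cexp_bounded hA). Qed.

Let EB_le i : `|EB f i 0| <= M.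
Proof. by rewrite mxE; exact: (cexp_bounded hB). Qed.

Let EA_mean : \sum_i fine (P (A i)) * EA f i 0 = mu f.
Proof. by under eq_bigr do rewrite mxE; exact: (cexp_mean hA mf fM). Qed.

Let EB_mean : \sum_i pB i * EB f i 0 = mu f.
Proof. by under eq_bigr do rewrite mxE; exact: (cexp_mean hB mf fM). Qed.

Let mu_le : `|mu f| <= M.
Proof.
rewrite -EB_mean (le_trans (ler_norm_sum _ _ _))//.
rewrite -[M]mul1r -(partition_prob_sum hB) mulr_suml; apply: ler_sum => i _.
by rewrite normrM ger0_norm ?ler_wpM2l// ltW// partition_gt0.
Qed.

Lemma cexp_vec_diff_le i : `|vB f i 0| <= 2 * M.
Proof.
rewrite /vB !mxE -[X in `|_ + X|]/(- (\sum_j _)).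
rewrite (le_trans (ler_normB _ _))// mulr_natl mulr2n lerD//.
  by have := EB_le i; rewrite mxE.
by have := stochastic_mulmx_le (cond_mx_stochastic hB hA) EA_le i; rewrite mxE.
Qed.

(** Both vectors of conditional expectations average to [P(f)]. *)
Lemma cexp_vec_diff_mean : \sum_i pB i * vB f i 0 = 0.
Proof.
transitivity (\sum_i (pB i * EB f i 0 - pB i * (PAB *m EA f) i 0)).
  by apply: eq_bigr => i _; rewrite -mulrBr /vB !mxE.
by rewrite sumrB EB_mean (cond_mx_mean hB hA) EA_mean subrr.
Qed.

Lemma cexp_vec_center_le i : `|eB f i 0| <= 2 * M.
Proof.
rewrite mxE [X in _ + X]mxE [X in - X]mxE (le_trans (ler_normB _ _))//.
by rewrite mulr_natl mulr2n lerD.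
Qed.

Lemma cexp_vec_center_mean : \sum_i pB i * eB f i 0 = 0.
Proof.
transitivity (\sum_i (pB i * EB f i 0 - pB i * mu f)).
  by apply: eq_bigr => i _; rewrite -mulrBr /eB !mxE.
by rewrite sumrB EB_mean -mulr_suml (partition_prob_sum hB) mul1r subrr.
Qed.

Let eBE : EB f = eB f + const_mx (mu f).
Proof. by rewrite /eB subrK. Qed.

Lemma expr_cexp_vec k : TB ^+ k *m EB f = TB ^+ k *m eB f + const_mx (mu f).
Proof.
rewrite {1}eBE mulmxDr stochastic_mulmx_const//; apply: stochastic_mx_expr.
exact: cond_mx2_stochastic hB hA.
Qed.

(** Applying [PBA] to the terms of the other series and intertwining, the sum of the two series
    telescopes in [TA ^+ k *m EA f]. The study of [S1even] is thus reduced to that of [S2odd]. *)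
Lemma S1even_partial N :
  S1even_sum P A B N f =
  EA f - PBA *m S2odd_sum P A B N f - TA ^+ N.+1 *m EA f.
Proof.
rewrite /S1even_sum /S2odd_sum; elim: N => [|N IH].
  rewrite !big_ord_recr !big_ord0 /= !add0r !expr0 !mul1mx expr1.
  by rewrite mulmxBr mulmxA opprB addrA addrAC addrK.
rewrite big_ord_recr [in RHS]big_ord_recr /= IH (mulmxDr PBA) mulmx_cond_expr.
rewrite -/TA -/PAB -/PBA -/EA -/EB (mulmxBr PBA) !(mulmxBr (TA ^+ N.+1)).
rewrite (mulmxA PBA PAB) -/TA (mulmxA (TA ^+ N.+1) TA).
have -> : TA ^+ N.+1 *m TA = TA ^+ N.+2 by rewrite [RHS]exprSr -mulmxE.
set a := EA f; set b := PBA *m \sum_(_ < _) _.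
set c := TA ^+ N.+1 *m a; set e := TA ^+ N.+1 *m _; set g := TA ^+ N.+2 *m _.
by rewrite addrA subrK opprD opprB !addrA addrAC addrK.
Qed.

(** * Identification of the limits, given the decay on mean-zero vectors *)

Section mean_zero_decay.
Variables (rho C : R).
Hypotheses (rho01 : 0 < rho < 1) (C0 : 0 < C).
Let r0 : 0 < rho. Proof. by case/andP: rho01. Qed.
Let r1 : rho < 1. Proof. by case/andP: rho01. Qed.
Hypothesis decay : forall (x : 'cV[R]_m2) b, \sum_i pB i * x i 0 = 0 ->
  (forall i, `|x i 0| <= b) ->
  forall k i, `|(TB ^+ k *m x) i 0| <= C * b * rho ^+ k.

Lemma S2odd_cvg : S2odd_sum P A B N f @[N --> \oo] --> S2odd P A B f /\
  forall N i, `|(S2odd_sum P A B N f - S2odd P A B f) i 0| <=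
    C * (2 * M) / (1 - rho) * rho ^+ N.
Proof.
have [] := geometric_series_cV rho01 _
  (decay cexp_vec_diff_mean cexp_vec_diff_le).
  by rewrite !mulr_ge0// ltW.
move=> c t; split => // N i.
(* [S2odd_sum] at [N] has [N.+1] terms, hence the remainder at [N.+1]. *)
rewrite -opprB mxE normrN; apply: le_trans (t N.+1 i) _.
rewrite ler_wpM2l ?divr_ge0 ?mulr_ge0 ?(ltW C0) ?subr_ge0 ?(ltW r1)//.
by rewrite exprS ler_piMl ?exprn_ge0 ?(ltW r0) ?(ltW r1).
Qed.

(** The limit form of [S1even_partial]: by ergodicity the last term [TA ^+ N.+1 *m EA f] tends to
    the constant vector [P(f)]. *)
Lemma S1evenE :
  S1even P A B f = EA f - PBA *m S2odd P A B f - const_mx (mu f).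
Proof.
set L := RHS.
pose eA := EA f - const_mx (mu f).
(* One application of [PAB] sends the centered vector [eA] to the side of [B], where the decay
   hypothesis applies; [PBA] brings the result back. *)
have TAE N : TA ^+ N.+1 *m EA f =
    const_mx (mu f) + PBA *m (TB ^+ N *m (PAB *m eA)).
  rewrite mulmx_cond_expr (mulmxA PBA) -/TA (mulmxA (TA ^+ N)).
  have -> : TA ^+ N *m TA = TA ^+ N.+1 by rewrite [RHS]exprSr -mulmxE.
  rewrite /eA mulmxBr stochastic_mulmx_const ?subrKC//.
  apply: stochastic_mx_expr.
  exact: cond_mx2_stochastic hA hB.
have eA_mean : \sum_i pB i * (PAB *m eA) i 0 = 0.
  rewrite (cond_mx_mean hB hA).
  transitivity (\sum_i (fine (P (A i)) * EA f i 0 - fine (P (A i)) * mu f)).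
    by apply: eq_bigr => i _; rewrite -mulrBr /eA !mxE.
  by rewrite sumrB EA_mean -mulr_suml (partition_prob_sum hA) mul1r subrr.
have eA_le i : `|(PAB *m eA) i 0| <= 2 * M.
  apply: stochastic_mulmx_le (cond_mx_stochastic hB hA) _ _ => j.
  rewrite mxE [X in _ + X]mxE [X in - X]mxE (le_trans (ler_normB _ _))//.
  by rewrite mulr_natl mulr2n lerD.
have [_ tl] := S2odd_cvg.
have sPBA := cond_mx_stochastic hA hB.
pose c := C * (2 * M) / (1 - rho) + C * (2 * M).
apply: (cvg_lim _) => //; apply: (@cvg_geometric_cV _ _ _ _ c rho) => //.
  by rewrite addr_ge0 ?divr_ge0 ?mulr_ge0 ?(ltW C0) ?subr_ge0 ?(ltW r1)//.
move=> N i.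
have -> : S1even_sum P A B N f - L =
   - (PBA *m (S2odd_sum P A B N f - S2odd P A B f))
   - PBA *m (TB ^+ N *m (PAB *m eA)).
  rewrite S1even_partial TAE /L (mulmxBr PBA (S2odd_sum _ _ _ _ _)).
  move: (PBA *m S2odd_sum P A B N f) (PBA *m S2odd P A B f) (EA f) => s s' a.
  move: (PBA *m _) (const_mx _) => t c'.
  by apply/colP => j; rewrite !mxE; ring.
rewrite mxE [X in `|X + _|]mxE [X in `|_ + X|]mxE.
rewrite (le_trans (ler_normB _ _))// normrN mulrDl lerD//.
  by apply: stochastic_mulmx_le sPBA _ _ => j; exact: tl.
by apply: stochastic_mulmx_le sPBA _ _ => j; exact: decay.
Qed.

Lemma S2odd_le i : `|S2odd P A B f i 0| <= C * (2 * M) / (1 - rho).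
Proof.
have [|_ /(_ 0%N i)] := geometric_series_cV rho01 _
  (decay cexp_vec_diff_mean cexp_vec_diff_le).
  by rewrite !mulr_ge0// ltW.
by rewrite big_ord0 subr0 expr0 mulr1.
Qed.

Lemma S1even_le i :
  `|S1even P A B f i 0| <= M + C * (2 * M) / (1 - rho) + M.
Proof.
have := stochastic_mulmx_le (cond_mx_stochastic hA hB) S2odd_le i.
rewrite S1evenE -/PBA; move: (PBA *m _) => y yb.
rewrite mxE [X in X + _]mxE [X in _ + X + _]mxE.
rewrite [X in _ - _ + X]mxE [const_mx _ _ _]mxE.
rewrite (le_trans (ler_normB _ _))// lerD//.
by rewrite (le_trans (ler_normB _ _))// lerD.
Qed.

Lemma S2evenE : S2even P A B f = S2odd P A B f + const_mx (mu f).
Proof.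
have [_ tl] := S2odd_cvg.
pose c := C * (2 * M) / (1 - rho) + C * (2 * M).
apply: (cvg_lim _) => //; apply: (@cvg_geometric_cV _ _ _ _ c rho) => //.
  by rewrite addr_ge0 ?divr_ge0 ?mulr_ge0 ?(ltW C0) ?subr_ge0 ?(ltW r1)//.
move=> N i.
have -> : S2even_sum P A B N f - (S2odd P A B f + const_mx (mu f)) =
   (S2odd_sum P A B N f - S2odd P A B f) + TB ^+ N.+1 *m eB f.
  rewrite /S2even_sum expr_cexp_vec.
  move: (S2odd_sum P A B N f) (S2odd P A B f) => s s'.
  move: (TB ^+ N.+1 *m _) (const_mx _) => t c'.
  by apply/colP => j; rewrite !mxE; ring.
rewrite mxE (le_trans (ler_normD _ _))// mulrDl lerD//.
apply: le_trans (decay cexp_vec_center_mean cexp_vec_center_le _ _) _.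
rewrite ler_wpM2l ?mulr_ge0 ?(ltW C0)//.
by rewrite exprS ler_piMl ?exprn_ge0 ?(ltW r0) ?(ltW r1).
Qed.

(** * Decay at the given rate, with a constant independent of [c] *)

Section rates.
Variables (l c : R).
Hypotheses (l0 : 0 < l).
Hypothesis even_rate :
  forall N, `|S2even_sum P A B N f - S2even P A B f| <= c * l ^+ N.
Hypothesis odd_rate :
  forall N, `|S2odd_sum P A B N f - S2odd P A B f| <= c * l ^+ N.

Let c0 : 0 <= c.
Proof. by have := le_trans (normr_ge0 _) (odd_rate 0); rewrite expr0 mulr1. Qed.

(** The constant [c] only serves to show that the orbit rescaled by [l] is bounded; reversibility
    then replaces it by one depending on [pB] and [M]. *)
Let combine (x : 'cV[R]_m2) :
  (forall i, `|x i 0| <= 2 * M) ->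
  (forall k i, `|(TB ^+ k.+1 *m x) i 0| <= 2 * c * l ^+ k + 2 * c * l ^+ k.+1) ->
  forall k i, `|(TB ^+ k *m x) i 0| <= (\sum_j (pB j)^-1) * (2 * M) * l ^+ k.
Proof.
move=> x0 xS k i.
(* The summand [2 * M] covers [k = 0]; dividing by [l] absorbs the shift from [l ^+ k] to
   [l ^+ k.+1]. *)
apply: (@reversible_geometric _ _ pB TB x (2 * M + 2 * c / l + 2 * c)) => //.
- by move=> j; exact: partition_gt0.
- exact: cond_mx2_reversible A hB.
- exact: partition_prob_sum hB.
case=> [|n] j.
  rewrite !expr0 mul1mx mulr1; apply: le_trans (x0 j) _.
  by rewrite -addrA lerDl addr_ge0// ?divr_ge0 ?mulr_ge0 ?(ltW l0).
apply: le_trans (xS n j) _.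
have -> : (2 * M + 2 * c / l + 2 * c) * l ^+ n.+1 =
    2 * M * l ^+ n.+1 + (2 * c * l ^+ n + 2 * c * l ^+ n.+1).
  by rewrite exprS; field; rewrite gt_eqF.
by rewrite lerDr !mulr_ge0 ?exprn_ge0 ?(ltW l0).
Qed.

(** The vector [TB ^+ n.+1 *m vB f] is the difference of two consecutive partial sums, both close to
    the same limit. *)
Lemma cexp_vec_diff_rate k i :
  `|(TB ^+ k *m vB f) i 0| <= (\sum_j (pB j)^-1) * (2 * M) * l ^+ k.
Proof.
apply: combine; first exact: cexp_vec_diff_le.
move=> n j.
have -> : TB ^+ n.+1 *m vB f =
    (S2odd_sum P A B n.+1 f - S2odd P A B f) - (S2odd_sum P A B n f - S2odd P A B f).
  by rewrite opprB addrA subrK /S2odd_sum big_ord_recr /= addrAC subrr add0r.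
rewrite mxE [X in _ + X]mxE (le_trans (ler_normB _ _))// addrC lerD//.
  apply: le_trans (cV_norm_ge _ _) _; apply: le_trans (odd_rate _) _.
  by rewrite ler_wpM2r ?exprn_ge0 ?(ltW l0)//; have := c0; lra.
apply: le_trans (cV_norm_ge _ _) _; apply: le_trans (odd_rate _) _.
by rewrite ler_wpM2r ?exprn_ge0 ?(ltW l0)//; have := c0; lra.
Qed.

(** The even and odd sums differ by [TB ^+ n.+1 *m EB f] and their limits by the constant vector
    [P(f)], so the difference of the two errors is the centered orbit. *)
Lemma cexp_vec_center_rate k i :
  `|(TB ^+ k *m eB f) i 0| <= (\sum_j (pB j)^-1) * (2 * M) * l ^+ k.
Proof.
apply: combine; first exact: cexp_vec_center_le.
move=> n j.
have -> : TB ^+ n.+1 *m eB f =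
    (S2even_sum P A B n f - S2even P A B f) - (S2odd_sum P A B n f - S2odd P A B f).
  rewrite S2evenE /S2even_sum expr_cexp_vec.
  move: (S2odd_sum P A B n f) (S2odd P A B f) => s s'.
  move: (TB ^+ n.+1 *m _) (const_mx _) => t c'.
  by apply/colP => h; rewrite !mxE; ring.
rewrite mxE [X in _ + X]mxE (le_trans (ler_normB _ _))//.
apply: (@le_trans _ _ (2 * c * l ^+ n)).
  rewrite -mulrA mulr_natl mulr2n lerD//.
    exact: le_trans (cV_norm_ge _ _) (even_rate _).
  exact: le_trans (cV_norm_ge _ _) (odd_rate _).
by rewrite lerDl !mulr_ge0 ?exprn_ge0 ?(ltW l0)//.
Qed.

End rates.

(** * Pointwise distance between a raked path and its limit *)

Section difference.
Variable z : (X -> R) -> R.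
Hypotheses (zA : \sum_i z \1_(A i) = 0) (zB : \sum_j z \1_(B j) = 0).
Let b1 := raked_once P A B z.

(** [PBA] preserves constants, so the entries of [b1] sum to the total over [B] minus the total over
    [A], and both are 0. *)
Let b1_sum : ((const_mx (mu f) : 'cV_m2)^T *m b1) 0 0 = 0.
Proof.
rewrite /b1 /raked_once col_dotBr mulmxA -trmx_mul.
rewrite stochastic_mulmx_const; last exact: cond_mx_stochastic.
rewrite !mxE.
under eq_bigr do rewrite !mxE.
under [X in _ - X]eq_bigr do rewrite !mxE.
by rewrite -!mulr_sumr zA zB !mulr0 subrr.
Qed.

(** In [S1evenE] the constant part pairs to 0 with the values on [A], and the part in [PBA *m S2odd]
    turns [G[B]] into [b1]. The limit then has the shape of [raked_oddE]. *)
Lemma raked_limitE :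
  raked_limit P A B z f =
  z f - ((EA f)^T *m eval_vec z A) 0 0 - ((S2odd P A B f)^T *m b1) 0 0.
Proof.
have cA : ((const_mx (mu f) : 'cV_m1)^T *m eval_vec z A) 0 0 = 0.
  rewrite mxE; under eq_bigr do rewrite !mxE.
  by rewrite -mulr_sumr zA mulr0.
rewrite /raked_limit S1evenE !col_dotBl cA /b1 /raked_once col_dotBr.
by rewrite trmx_mul mulmxA; ring.
Qed.

Lemma raked_diff_le (c r : R) N : 0 < r < 1 ->
  (forall k i, `|(TB ^+ k *m vB f) i 0| <= c * r ^+ k) ->
  (forall k i, `|(TB ^+ k *m eB f) i 0| <= c * r ^+ k) ->
  `|raked P A B N.+1 z f - raked_limit P A B z f| <=
    2 * c / (1 - r) * r ^+ N./2 * \sum_j `|b1 j 0|.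
Proof.
move=> r01 vr er.
have /andP[r0' r1'] := r01.
have [j0|noj] := pselect (exists j : 'I_m2, True); last first.
  have := partition_prob_sum hB.
  rewrite big1 => [/esym/eqP|j]; first by rewrite oner_eq0.
  by case: noj; exists j.
have c0 : 0 <= c.
  case: j0 => j _; have := le_trans (normr_ge0 _) (vr 0%N j).
  by rewrite expr0 mulr1.
have [_ tl] := geometric_series_cV r01 c0 vr.
have odd_le m : `|raked P A B m.*2.+1 z f - raked_limit P A B z f| <=
    c / (1 - r) * r ^+ m * \sum_j `|b1 j 0|.
  rewrite raked_oddE// raked_limitE -/PAB -/PBA -/TB -/EA -/EB -/b1.
  set a := z f - _; set s := (_^T *m b1) 0 0; set s' := (_^T *m b1) 0 0.
  have -> : a - s - (a - s') = s' - s by ring.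
  by rewrite -col_dotBl; apply: col_dot_norm_le => i; exact: tl.
have b0 : 0 <= \sum_j `|b1 j 0| by exact: sumr_ge0.
have c1 : c / (1 - r) <= 2 * c / (1 - r).
  by rewrite ler_wpM2r ?invr_ge0; lra.
(* With [m = N./2], the index [N.+1] is [2m+1] for even [N] and [2m+2] for odd [N]; the odd index
   leaves only the remainder of the series. *)
rewrite -[N in raked _ _ _ N.+1]odd_double_half; case: (odd N); last first.
  apply: le_trans (odd_le _) _; rewrite -mulrA -[leRHS]mulrA.
  by rewrite ler_wpM2r// mulr_ge0 ?exprn_ge0 ?(ltW r0').
rewrite add1n raked_evenE//.
set m := N./2; set s := (_ *m raked_once P A B z) 0 0.
(* The extra term of an even index does not see the constant part of [EB f], by [b1_sum], so its
   decay is that of the centered vector. *)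
have sE : s = ((TB ^+ m *m eB f)^T *m b1) 0 0.
  by rewrite /s -/PAB -/PBA -/TB -/EB expr_cexp_vec col_dotDl -/b1 b1_sum addr0.
rewrite addrAC (le_trans (ler_normB _ _))//.
apply: (@le_trans _ _ ((c / (1 - r) * r ^+ m * \sum_j `|b1 j 0|)
   + c * r ^+ m * \sum_j `|b1 j 0|)).
  by rewrite lerD// sE; apply: col_dot_norm_le => i; exact: er.
rewrite -mulrDl -mulrDl ler_wpM2r// ler_wpM2r ?exprn_ge0 ?(ltW r0')//.
rewrite -mulrA mulr_natl mulr2n lerD2l ler_peMr// invf_ge1; lra.
Qed.

End difference.

End mean_zero_decay.
End one_function.
End raking_limit.

(** * Gaussian tails *)

Section gaussian_tail.
Context {R : realType}.
Local Notation leb := (@lebesgue_measure R).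

Lemma measurable_normr_gt (t : R) : measurable [set x : R | t < `|x|].
Proof.
rewrite (_ : mkset _ = ~` `[- t, t]%classic); first exact: measurableC.
apply/seteqP; split => x; rewrite /= in_itv/= -ler_norml.
  by rewrite ltNge => /negP.
by move/negP; rewrite -ltNge.
Qed.

Lemma normal_peak_le (s : R) : 0 < s -> normal_peak s <= (2 * s)^-1.
Proof.
move=> s0; rewrite /normal_peak lef_pV2 ?posrE ?mulr_gt0//; last first.
  by rewrite sqrtr_gt0 mulrn_wgt0// mulr_gt0 ?pi_gt0// exprn_gt0.
rewrite -[leLHS]gtr0_norm ?mulr_gt0// -sqrtr_sqr ler_wsqrtr//.
have : 0 <= s ^+ 2 * (pi - 2) by rewrite mulr_ge0 ?sqr_ge0// subr_ge0 pi_ge2.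
by rewrite exprMn -mulr_natr; lra.
Qed.

Lemma normal_prob_ball_le (m s b r : R) : 0 < s -> 0 <= r ->
  (forall x, `|x| < r -> normal_pdf m s x <= b) ->
  (normal_prob m s [set x | (`|x| < r)%R] <= (b * (2 * r))%:E)%E.
Proof.
move=> s0 r0 pb.
have E : [set x : R | `|x| < r] = `]-r, r[%classic.
  by apply/seteqP; split => x /=; rewrite in_itv/= ltr_norml.
rewrite /normal_prob; set D := [set x | _] in E *.
have mD : measurable D by rewrite E.
apply: (@le_trans _ _ (\int[leb]_(x in D) b%:E)%E).
  apply: ge0_le_integral => //=.
  - by move=> x _; rewrite lee_fin normal_pdf_ge0.
  - by apply/measurable_EFinP/measurable_funTS; exact: measurable_normal_pdf.
rewrite integral_cst//= E lebesgue_measure_itv/= lte_fin.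
case: ifPn => [_|rr]; first by rewrite -EFinD -EFinM lee_fin; lra.
have r00 : r = 0 by lra.
by rewrite mule0 r00 !mulr0.
Qed.

(* Chebyshev puts mass 3/4 on (-2, 2), where the density is at most
   [normal_peak s <= 1 / (2 s)], and at most
   [expR (- (`|m| - 2) ^+ 2 / (2 s ^+ 2)) / (2 s) <= 1 / (2 (`|m| - 2))]
   if [2 < `|m|]. *)
Lemma normal_param_le (m s : R) : 0 < s ->
  ((3 / 4)%:E <= normal_prob m s [set x | (`|x| < 2)%R])%E ->
  s <= 8 / 3 /\ `|m| <= 14 / 3.
Proof.
move=> s0 H.
(* The interval has length 4, so a density at most [1 / (2a)] gives [3/4 <= 2/a]. *)
have key a : 0 < a -> (forall x, `|x| < 2 -> normal_pdf m s x <= (2 * a)^-1) ->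
    a <= 8 / 3.
  move=> a0 pa; have := le_trans H (normal_prob_ball_le s0 (ler0n R 2) pa).
  by rewrite lee_fin [_^-1 * _]mulrC ler_pdivlMr ?mulr_gt0//; lra.
split.
  apply: key => // x _; apply: le_trans (normal_peak_le s0).
  exact: normal_pdf_ub (lt0r_neq0 s0).
rewrite leNgt; apply/negP => mgt.
pose a := `|m| - 2; have a0 : 0 < a by rewrite /a; lra.
suff : a <= 8 / 3 by rewrite /a; lra.
apply: key => // x x2.
have ax : a ^+ 2 <= (x - m) ^+ 2.
  rewrite -[leRHS]real_normK ?num_real// lerXn2r ?nnegrE// ?(ltW a0)//.
  by rewrite distrC; have := lerB_dist m x; rewrite /a; lra.
rewrite /normal_pdf gt_eqF// invfM.
have -> : 2^-1 * a^-1 = (2 * s)^-1 * (s / a) by rewrite invfM; field; rewrite !gt_eqF.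
rewrite ler_pM ?normal_peak_ge0 ?normal_fun_ge0 ?normal_peak_le//.
(* With [u = a / s], the exponential of [u^2 / 2] is at least [1 + u^2 / 2], hence at least [u]. *)
rewrite /normal_fun mulNr expRN -[leRHS]invrK.
rewrite lef_pV2 ?posrE ?expR_gt0 ?invr_gt0 ?divr_gt0//.
rewrite invf_div; apply: le_trans (expR_ge1Dx _).
apply: (@le_trans _ _ (1 + (a / s) ^+ 2 / 2)).
  by have := sqr_ge0 (a / s - 1); set u := a / s; lra.
have -> : (x - m) ^+ 2 / (s ^+ 2 *+ 2) = (x - m) ^+ 2 / s ^+ 2 / 2.
  by field; rewrite gt_eqF.
rewrite lerD2l ler_wpM2r// expr_div_n ler_wpM2r//.
by rewrite invr_ge0 sqr_ge0.
Qed.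

(** The density is compared with that of standard deviation [2 * s]: on the tail their ratio is at
    most [2 * expR (- (t ^+ 2 / 128))], and the wider density has total mass 1. *)
Lemma normal_prob_tail (m s t : R) : 0 < s -> s <= 8 / 3 -> `|m| <= 14 / 3 ->
  10 <= t ->
  (normal_prob m s [set x | (t < `|x|)%R] <= (2 * expR (- (t ^+ 2 / 128)))%:E)%E.
Proof.
move=> s0 s_le m_le t10; set D := [set x | _].
have mD : measurable D := measurable_normr_gt t.
have s20 : 2 * s != 0 by rewrite gt_eqF// mulr_gt0.
pose k := 2 * expR (- (t ^+ 2 / 128)).
have k0 : 0 <= k by rewrite mulr_ge0 ?expR_ge0.
apply: (@le_trans _ _ (\int[leb]_(x in D) (k%:E * (normal_pdf m (2 * s) x)%:E))%E).
  apply: ge0_le_integral => //=.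
  - by move=> x _; rewrite lee_fin normal_pdf_ge0.
  - by apply/measurable_EFinP/measurable_funTS; exact: measurable_normal_pdf.
  - apply/measurable_EFinP/measurable_funTS/measurable_funM => //.
    exact: measurable_normal_pdf.
  move=> x Dx; have tx : t < `|x : R| := Dx.
  rewrite -EFinM lee_fin /normal_pdf (gt_eqF s0) (negbTE s20).
  have -> : normal_peak s = 2 * normal_peak (2 * s).
    rewrite /normal_peak.
    have -> : (2 * s) ^+ 2 * pi *+ 2 = 2 ^+ 2 * (s ^+ 2 * pi *+ 2) by ring.
    by rewrite (sqrtrM _ (sqr_ge0 2)) sqrtr_sqr ger0_norm// invfM mulVKf.
  rewrite /k [leRHS]mulrACA ler_wpM2l ?mulr_ge0 ?normal_peak_ge0//.
  rewrite /normal_fun -expRD ler_expR.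
  (* From [10 <= t] follows [14 / 3 <= t / 2], so the tail is at distance at least [t / 2] from
     [m]. *)
  have xm : t / 2 <= `|x - m|.
    apply: le_trans (lerB_dist _ _); lra.
  have xm2 : (t / 2) ^+ 2 <= (x - m) ^+ 2.
    rewrite -[leRHS]real_normK ?num_real// lerXn2r ?nnegrE//; lra.
  have s2 : 0 < s ^+ 2 by rewrite exprn_gt0.
  have s2le : s ^+ 2 <= 64 / 9.
    have -> : 64 / 9 = (8 / 3) ^+ 2 :> R by field.
    by rewrite lerXn2r ?nnegrE//; lra.
  set y := (x - m) ^+ 2 in xm2 *.
  have u : 9 / 256 * t ^+ 2 <= y / s ^+ 2.
    rewrite ler_pdivlMr//; apply: le_trans xm2.
    have : t ^+ 2 * s ^+ 2 <= t ^+ 2 * (64 / 9) by rewrite ler_wpM2l ?sqr_ge0.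
    by rewrite expr_div_n; lra.
  have -> : - y / (s ^+ 2 *+ 2) = - (y / s ^+ 2) / 2 by field; rewrite gt_eqF.
  have -> : - y / ((2 * s) ^+ 2 *+ 2) = - (y / s ^+ 2) / 8 by field; rewrite gt_eqF.
  by have := sqr_ge0 t; lra.
rewrite ge0_integralZl//; first last.
- by move=> x _; rewrite lee_fin normal_pdf_ge0.
- by apply/measurable_EFinP/measurable_funTS; exact: measurable_normal_pdf.
rewrite -[leRHS]mule1; apply: lee_pmul => //.
  by apply: integral_ge0 => x _; rewrite lee_fin normal_pdf_ge0.
rewrite -(integral_normal_pdf m (2 * s)); apply: ge0_subset_integral => //.
- by apply/measurable_EFinP; exact: measurable_normal_pdf.
- by move=> x _; rewrite lee_fin normal_pdf_ge0.
Qed.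

End gaussian_tail.

Section gaussian_rv_tail.
Context {R : realType} {d : measure_display} {Omega : measurableType d}.
Variable Pr : probability Omega R.

Lemma measurable_norm_gt (Y : Omega -> R) (t : R) : measurable_fun setT Y ->
  measurable [set w | t < `|Y w|].
Proof.
move=> mY; rewrite -[X in measurable X]setTI.
exact: mY measurableT _ (measurable_normr_gt t).
Qed.

(** The parameters [m] and [s] of the law are not computed from its moments: Chebyshev's inequality
    gives mass at least 3/4 to (-2, 2), which already bounds both. *)
Lemma gaussian_rv_tail (Y : Omega -> R) (t : R) : gaussian_rv Pr Y ->
  ('E_Pr[Y] = 0)%E -> (covariance Pr Y Y <= 1)%E -> 10 <= t ->
  (Pr [set w | (t < `|Y w|)%R] <= (2 * expR (- (t ^+ 2 / 128)))%:E)%E.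
Proof.
move=> [mY [m [s [s0 law]]]] EY VY t10.
pose Z : {RV Pr >-> R} := HB.pack Y (isMeasurableFun.Build _ _ _ _ Y mY).
have mball : measurable [set x : R | `|x| < 2].
  rewrite (_ : [set x | _] = `]-2, 2[%classic)//.
  by apply/seteqP; split => x /=; rewrite in_itv/= ltr_norml.
have mtail : measurable [set x : R | t < `|x|].
  exact: measurable_normr_gt.
have half : ((3 / 4)%:E <= normal_law m s [set x | (`|x| < 2)%R])%E.
  rewrite -law//; set E := Y @^-1` _.
  have mE : measurable E by rewrite -[E]setTI; exact: (mY measurableT _ mball).
  have EC : [set w | 2 <= `|Z w - fine ('E_Pr[Z])%E|] = ~` E.
    apply/seteqP; split => w; rewrite /E/= EY/= subr0 leNgt; first by move/negP.
    by move/negP.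
  have := chebyshev Z (ltr0n R 2); rewrite EC probability_setC// => H.
  have {}H : (1 - Pr E <= (4^-1)%:E)%E.
    apply: le_trans H _; apply: (@le_trans _ _ ((2 ^- 2)%:E * 1)%E).
      by rewrite lee_wpmul2l// lee_fin invr_ge0 exprn_ge0.
    by rewrite mule1 lee_fin; lra.
  move: H; rewrite leeBlDr ?fin_num_measure// -leeBlDl//.
  by apply: le_trans; rewrite -EFinB lee_fin; lra.
rewrite -[X in Pr X]/(Y @^-1` [set x | t < `|x|]) law//.
(* If [s = 0] the law is a point mass, which must sit in (-2, 2) and so does not charge the tail
   beyond [t]. *)
move: half; rewrite /normal_law; have [_|sn0] := eqVneq s 0.
  rewrite diracE; case: (boolP (m \in _)) => [|_].
    rewrite inE /= => m2 _; rewrite diracE memNset /=; last first.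
      by move=> tm; have := lt_trans tm m2; lra.
    by rewrite lee_fin mulr_ge0 ?expR_ge0.
  by rewrite lee_fin leNgt divr_gt0.
have sgt : 0 < s by rewrite lt_neqAle eq_sym sn0.
by move=> /(normal_param_le sgt) [? ?]; exact: normal_prob_tail.
Qed.

End gaussian_rv_tail.

(** * Bounding the Levy-Prokhorov distance by a coupling *)

Section levy_prokhorov_bound.
Context {R : realType} {T : Type} {d : measure_display}
  {Omega : measurableType d}.
Variable Pr : probability Omega R.

(** Off [E], a path of [Y] in [D] puts that of [Z] in the enlargement. Monotonicity and
    subadditivity of the outer measure suffice, without measurability of the path events. *)
Lemma linf_law_le (Y Z : Omega -> linf R T) (E : set Omega) (eps : R) D :
  measurable E -> (Pr E <= eps%:E)%E ->
  (forall w, ~ E w -> `|Y w - Z w| < eps) ->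
  (linf_law Pr Y D <= linf_law Pr Z (enlarge D eps) + eps%:E)%E.
Proof.
move=> mE Ee YZ; rewrite /linf_law.
apply: (@le_trans _ _ (mu_ext Pr (Z @^-1` enlarge D eps `|` E))).
  apply: le_mu_ext => w /= Dw; have [Ew|nEw] := pselect (E w); [by right|left].
  by exists (Y w) => //; rewrite distrC; exact: YZ.
apply: le_trans (outer_measureU2 _ _ _) _.
by apply: leeD => //; rewrite /= measurable_mu_extE.
Qed.

Lemma dLP_le (Y Z : Omega -> linf R T) (E : set Omega) (eps : R) :
  0 < eps -> measurable E -> (Pr E <= eps%:E)%E ->
  (forall w, ~ E w -> `|Y w - Z w| < eps) -> dLP Pr Y Z <= eps.
Proof.
move=> e0 mE Ee YZ; apply: ge_inf; first by exists 0 => x [/ltW].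
split => // D _; split; apply: linf_law_le mE Ee _ => // w /YZ.
by rewrite distrC.
Qed.

End levy_prokhorov_bound.

(** * Powers with halved exponents *)

(** Dividing by [l] pays for the rounding: [(n + 1) / 2] is at most [n./2 + 1]. *)
Lemma expr_half_le {R : realType} (l : R) n : 0 < l < 1 ->
  l ^+ n./2 <= l `^ (n.+1%:R / 2) / l.
Proof.
move=> /andP[l0 l1]; rewrite ler_pdivlMr// -exprSr -(powR_mulrn _ (ltW l0)).
apply: ger_powR; first by rewrite l0 ltW.
rewrite ler_pdivrMr// -natrM ler_nat muln2 -[in X in (X <= _)%N](odd_double_half n).
by rewrite doubleS ltnS -add1n leq_add2r; case: odd.
Qed.

Lemma cvg_expr_half {R : realType} (l c : R) : 0 < l < 1 ->
  c * l ^+ n./2 @[n --> \oo] --> (0 : R).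
Proof.
move=> /andP[l0 l1].
have half_oo : n./2 @[n --> \oo] --> \oo.
  move=> S [N _ NS]; exists N.*2 => // n /= Nn; apply: NS => /=.
  by rewrite -(doubleK N) half_leq.
have cl : c * l ^+ n @[n --> \oo] --> (0 : R).
  by apply: cvg_geometric; rewrite gtr0_norm.
exact: (cvg_comp (fun n => n./2) (fun n => c * l ^+ n) half_oo cl).
Qed.

(** * Sums of zero second moment *)

Section null_sum.
Context {R : realType} {d : measure_display} {Omega : measurableType d}.
Variable Pr : probability Omega R.

Lemma square_integrable_mul (X Y : Omega -> R) :
  measurable_fun setT X -> measurable_fun setT Y ->
  (\int[Pr]_w (X w * X w)%:E < +oo)%E -> (\int[Pr]_w (Y w * Y w)%:E < +oo)%E ->
  Pr.-integrable setT (fun w => (X w * Y w)%:E).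
Proof.
move=> mX mY X2 Y2.
have sq (Z : Omega -> R) : measurable_fun setT Z ->
    (\int[Pr]_w (Z w * Z w)%:E < +oo)%E ->
    Pr.-integrable setT (fun w => (Z w * Z w)%:E).
  move=> mZ Z2; apply/integrableP; split.
    by apply/measurable_EFinP; exact: measurable_funM.
  under eq_integral do rewrite /= ger0_norm -?expr2 ?sqr_ge0//.
  by under eq_integral do rewrite expr2.
apply: (le_integrable measurableT _ _
  (integrableD measurableT (sq X mX X2) (sq Y mY Y2))).
  by apply/measurable_EFinP; exact: measurable_funM.
move=> w _; rewrite /= lee_fin; apply: le_trans (ler_norm _).
rewrite ler_norml; set x := X w; set y := Y w.
have := sqr_ge0 (x - y); have := sqr_ge0 (x + y); have := sqr_ge0 x.
by have := sqr_ge0 y => ? ? ? ?; apply/andP; split; lra.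
Qed.

(** The second moment of the sum is the total of the [c i j], so the square has integral 0 and
    vanishes almost everywhere. *)
Lemma sum_ae0 (n : nat) (Y : 'I_n -> Omega -> R) (c : 'I_n -> 'I_n -> R) :
  (forall i, measurable_fun setT (Y i)) ->
  (forall i j, \int[Pr]_w (Y i w * Y j w)%:E = (c i j)%:E)%E ->
  \sum_i \sum_j c i j = 0 ->
  measurable [set w | \sum_i Y i w != 0] /\ Pr [set w | \sum_i Y i w != 0] = 0%E.
Proof.
move=> mY Yc c0.
have mS : measurable_fun setT (fun w => \sum_i Y i w) by exact: measurable_sum.
have mE : measurable [set w | \sum_i Y i w != 0].
  rewrite (_ : mkset _ = (fun w => \sum_i Y i w) @^-1` (~` [set 0])).
    by rewrite -[X in measurable X]setTI; apply: mS => //; exact: measurableC.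
  by apply/seteqP; split => w /=; move/eqP.
split => //.
have iY i j : Pr.-integrable setT (fun w => (Y i w * Y j w)%:E).
  by apply: square_integrable_mul => //; rewrite Yc ltry.
have int0 : (\int[Pr]_w `|((\sum_i Y i w) ^+ 2)%:E| = 0)%E.
  transitivity (\sum_i \sum_j (c i j)%:E)%E; last first.
    under eq_bigr do rewrite sumEFin.
    by rewrite sumEFin c0.
  transitivity (\int[Pr]_w (\sum_i \sum_j (Y i w * Y j w)%:E))%E.
    apply: eq_integral => w _.
    rewrite /= ger0_norm ?sqr_ge0// expr2 mulr_suml -sumEFin.
    by apply: eq_bigr => i _; rewrite mulr_sumr sumEFin.
  rewrite integral_sum// => [|i]; last exact: integrable_sum.
  by apply: eq_bigr => i _; rewrite integral_sum//; apply: eq_bigr => j _.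
have := ae_eq_integral_abs Pr measurableT
  (f := fun w => ((\sum_i Y i w) ^+ 2)%:E) _.
move=> /(_ _)[|/(_ int0) + _].
  by apply/measurable_EFinP; exact: measurable_funX.
move=> [N [mN N0 sN]].
apply/eqP; rewrite -measure_le0 -N0; apply: le_measure; rewrite ?inE//.
move=> w /= Sw; apply: sN => /= /(_ I) [] /eqP.
by rewrite sqrf_eq0 (negbTE Sw).
Qed.

End null_sum.

(** * Bounded paths as elements of the sup-norm space *)

Section bounded_paths.
Context {R : realType} {d : measure_display} {X : measurableType d}.
Variable F : set (X -> R).

Lemma bounded_path_linf (z : (X -> R) -> R) : bounded_path F z ->
  (fun f : F => z (val f)) \in bounded_pred.
Proof.
move=> [K zK]; apply/bounded_predP; exists K => f.
by apply: zK; exact: set_valP.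
Qed.

Lemma bounded_path_sub_dot (m : nat) (D : 'I_m -> set X) (z y : (X -> R) -> R)
    (s : (X -> R) -> 'cV[R]_m) (c : R) : bounded_path F z ->
  (forall f i, F f -> `|s f i 0| <= c) ->
  bounded_path F (fun f => z f - ((s f)^T *m eval_vec y D) 0 0).
Proof.
move=> [K zK] sc; exists (K + c * \sum_i `|eval_vec y D i 0|) => f Ff.
rewrite (le_trans (ler_normB _ _))// lerD//; first exact: zK.
by apply: col_dot_norm_le => i; exact: sc.
Qed.

End bounded_paths.

(** * The Brownian bridge on a partition *)

Section bridge.
Context {R : realType} {d d' : measure_display} {X : measurableType d}
  {Omega : measurableType d'}.
Variables (P : probability X R) (Pr : probability Omega R).
Variables (F : set (X -> R)) (G : Omega -> (X -> R) -> R).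
Hypothesis hG : brownian_bridge Pr P F G.

Lemma bridge_rv f : F f -> gaussian_rv Pr (fun w => G w f).
Proof.
move=> Ff; have [[gp _] _ _ _] := hG.
have := gp 1 (fun=> f) (fun=> 1) (fun=> Ff).
by under eq_fun do rewrite big_ord1 mul1r.
Qed.

Lemma bridge_measurable f : F f -> measurable_fun setT (fun w => G w f).
Proof. by move=> /bridge_rv[]. Qed.

Lemma bridge_integral f g : F f -> F g ->
  (\int[Pr]_w (G w f * G w g)%:E =
  (\int[P]_x (f x * g x) - (\int[P]_x f x) * (\int[P]_x g x))%R%:E)%E.
Proof.
move=> Ff Fg; have [[_ E0] cv _ _] := hG.
rewrite -(cv f g Ff Fg) covariance.unlock !E0// expectation.unlock.
by apply: eq_integral => w _; rewrite !fctE /= !subr0.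
Qed.

Lemma bridge_integrable f : F f -> Pr.-integrable setT (fun w => (G w f)%:E).
Proof.
move=> Ff.
have -> : (fun w => (G w f)%:E) = (fun w => (G w f * cst 1 w)%:E).
  by apply/funext => w; rewrite mulr1.
apply: square_integrable_mul => //; first exact: bridge_measurable.
  by rewrite bridge_integral// ltry.
rewrite (eq_integral (cst 1%E)) => [|w _]; last by rewrite /= mulr1.
by rewrite integral_cst// mul1e -ge0_fin_numE// fin_num_measure.
Qed.

Lemma bridge_comb_expectation n (h : 'I_n -> X -> R) (a : 'I_n -> R) :
  (forall k, F (h k)) -> ('E_Pr[fun w => (\sum_k a k * G w (h k))%R] = 0)%E.
Proof.
move=> Fh; have [[_ E0] _ _ _] := hG; rewrite expectation.unlock.
under eq_integral do rewrite -sumEFin.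
have ia k : Pr.-integrable setT (fun w => (a k * G w (h k))%:E).
  under eq_fun do rewrite EFinM.
  by apply: integrableZl => //; exact: bridge_integrable.
rewrite integral_sum// big1// => k _.
under eq_integral do rewrite EFinM.
rewrite integralZl//; last exact: bridge_integrable.
by have := E0 _ (Fh k); rewrite expectation.unlock => ->; rewrite mule0.
Qed.

Section partition.
Variables (m : nat) (D : 'I_m -> set X).
Hypotheses (hD : positive_partition P D) (FD : forall i, F \1_(D i)).

Let indic_le1 i x : `|\1_(D i) x : R| <= 1.
Proof. by rewrite indicE; case: (_ \in _); rewrite ?normr1 ?normr0. Qed.

(** Row [i] of the covariance matrix of the values on [D] sums to [P(D_i) - P(D_i) * 1 = 0]. *)
Lemma bridge_partition_sum :
  measurable [set w | \sum_i G w \1_(D i) != 0] /\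
  Pr [set w | \sum_i G w \1_(D i) != 0] = 0%E.
Proof.
have [mD _ _ _] := hD.
apply: (sum_ae0 (fun i => bridge_measurable (FD i))
  (fun i j => bridge_integral (FD i) (FD j))).
have pE i : \int[P]_x \1_(D i) x = fine (P (D i)) by exact: Rintegral_indic.
transitivity (\sum_i (fine (P (D i)) - fine (P (D i)) * 1)).
  apply: eq_bigr => i _; rewrite sumrB -mulr_sumr.
  rewrite (Rintegral_partition hD (M := 1)) => [||//]; last exact: measurable_indic.
  rewrite pE; congr (_ - _ * _).
  by under eq_bigr do rewrite pE; exact: partition_prob_sum hD.
by apply: big1 => i _; rewrite mulr1 subrr.
Qed.

Lemma bridge_partition_tail i (t : R) : 10 <= t ->
  (Pr [set w | (t < `|G w \1_(D i)|)%R] <= (2 * expR (- (t ^+ 2 / 128)))%:E)%E.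
Proof.
move=> t10; have [mD _ _ _] := hD; have [[_ E0] cv _ _] := hG.
apply: gaussian_rv_tail (bridge_rv (FD i)) (E0 _ (FD i)) _ t10.
rewrite cv// lee_fin Rintegral_indic//.
have -> : \int[P]_x (\1_(D i) x * \1_(D i) x) = fine (P (D i)).
  rewrite -Rintegral_indic//; apply: eq_Rintegral => x _.
  by rewrite indicE; case: (_ \in _); rewrite ?mulr1 ?mulr0.
have : fine (P (D i)) <= 1.
  rewrite -(partition_prob_sum hD) (bigD1 i)//= lerDl sumr_ge0// => j _.
  exact: fine_ge0.
by have := sqr_ge0 (fine (P (D i))); lra.
Qed.

End partition.
End bridge.

(** * Gaussianity of the limit *)

(** Linear combinations of the limit process are linear combinations of [z] at the [f k] and at the
    [m1 + m2] indicators, so the Gaussian law and the zero mean are inherited from the bridge. *)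
Lemma raked_limit_comb {R : realType} {d : measure_display}
    {X : measurableType d} (P : probability X R) (m1 m2 : nat)
    (A : 'I_m1 -> set X) (B : 'I_m2 -> set X) (F : set (X -> R)) (n : nat)
    (f : 'I_n -> X -> R) (a : 'I_n -> R) :
  (forall i, F \1_(A i)) -> (forall j, F \1_(B j)) -> (forall k, F (f k)) ->
  exists (h : 'I_(n + (m1 + m2)) -> X -> R) (c : 'I_(n + (m1 + m2)) -> R),
    (forall k, F (h k)) /\
    forall z, \sum_k a k * raked_limit P A B z (f k) = \sum_k c k * z (h k).
Proof.
move=> FA FB Ff.
pose h k := match fintype.split k with
  | inl k => f k
  | inr u => match fintype.split u with inl i => \1_(A i) | inr j => \1_(B j) end
  end.
pose c k := match fintype.split k with
  | inl k => a k
  | inr u => match fintype.split u with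
    | inl i => - \sum_k a k * S1even P A B (f k) i 0
    | inr j => - \sum_k a k * S2odd P A B (f k) j 0
    end
  end.
exists h, c; split.
  by move=> k; rewrite /h; case: (fintype.split k) => // u; case: (fintype.split u).
move=> z; rewrite !big_split_ord /=.
have sl p q (i : 'I_p) : fintype.split (lshift q i) = inl i.
  exact: (unsplitK (inl i)).
have sr p q (i : 'I_q) : fintype.split (rshift p i) = inr i.
  exact: (unsplitK (inr i)).
have -> : \sum_(i < n) c (lshift (m1 + m2) i) * z (h (lshift (m1 + m2) i)) =
    \sum_(k < n) a k * z (f k).
  by apply: eq_bigr => i _; rewrite /c /h sl.
have dotE q (D : 'I_q -> set X) (s : (X -> R) -> 'cV[R]_q) :
    \sum_(k < n) a k * ((s (f k))^T *m eval_vec z D) 0 0 =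
    \sum_i (\sum_(k < n) a k * s (f k) i 0) * z \1_(D i).
  under eq_bigr do rewrite mxE mulr_sumr.
  rewrite exchange_big; apply: eq_bigr => i _ /=; rewrite mulr_suml.
  by apply: eq_bigr => k _; rewrite !mxE mulrA.
have -> : \sum_(i < m1) c (rshift n (lshift m2 i)) * z (h (rshift n (lshift m2 i))) =
    - \sum_(k < n) a k * ((S1even P A B (f k))^T *m eval_vec z A) 0 0.
  rewrite dotE -sumrN; apply: eq_bigr => i _.
  by rewrite /c /h sr sl mulNr.
have -> : \sum_(i < m2) c (rshift n (rshift m1 i)) * z (h (rshift n (rshift m1 i))) =
    - \sum_(k < n) a k * ((S2odd P A B (f k))^T *m eval_vec z B) 0 0.
  rewrite dotE -sumrN; apply: eq_bigr => i _.
  by rewrite /c /h sr sr mulNr.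
rewrite -!sumrN -!big_split /=; apply: eq_bigr => k _.
by rewrite /raked_limit; ring.
Qed.

Lemma raked_limit_gaussian {R : realType} {d d' : measure_display}
    {X : measurableType d} {Omega : measurableType d'} (P : probability X R)
    (Pr : probability Omega R) (m1 m2 : nat) (A : 'I_m1 -> set X)
    (B : 'I_m2 -> set X) (F : set (X -> R)) (G : Omega -> (X -> R) -> R) :
  brownian_bridge Pr P F G ->
  (forall i, F \1_(A i)) -> (forall j, F \1_(B j)) ->
  centered_gaussian_process Pr F (fun w => raked_limit P A B (G w)).
Proof.
move=> hG FA FB; have [[gp _] _ _ _] := hG; split=> [n f a Ff|f Ff].
  have [h [c [Fh hc]]] := raked_limit_comb P a FA FB Ff.
  by under eq_fun do rewrite hc; exact: gp.
have [h [c [Fh hc]]] :=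
  raked_limit_comb P (fun _ : 'I_1 => 1) FA FB (fun=> Ff : F f).
have := bridge_comb_expectation hG c Fh.
under [in X in (X -> _)%type]eq_fun do rewrite -hc big_ord1 mul1r.
by [].
Qed.

(** * Raked paths in the sup norm *)

Section raked_paths.
Context {R : realType} {d : measure_display} {X : measurableType d}.
Variables (P : probability X R) (m1 m2 : nat).
Variables (A : 'I_m1 -> set X) (B : 'I_m2 -> set X).
Hypotheses (hA : positive_partition P A) (hB : positive_partition P B).
Variables (M : R) (F : set (X -> R)).
Hypotheses (mF : forall f, F f -> measurable_fun setT f)
  (FM : forall f, F f -> forall x, `|f x| <= M).

Lemma raked_bounded_path N z :
  bounded_path F z -> bounded_path F (raked P A B N z).
Proof.
move=> Fz; have step m (D : 'I_m -> set X) y : positive_partition P D ->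
    bounded_path F y -> bounded_path F (rake_step P D y).
  move=> hD Fy; rewrite (funext (rake_stepE P D y)).
  apply: (@bounded_path_sub_dot _ _ _ _ _ _ _ _ _ M) => // f i Ff.
  by rewrite mxE; apply: cexp_bounded; [|exact: mF|exact: FM].
by elim: N => //= N IH; case: ifP => _; exact: step.
Qed.

Lemma raked_limit_bounded_path z : ER P A B ->
  bounded_path F z -> bounded_path F (raked_limit P A B z).
Proof.
move=> hER Fz; have [rho [C [r01 C0 dec]]] := ER_geometric hA hB hER.
rewrite /raked_limit; apply: bounded_path_sub_dot.
  apply: bounded_path_sub_dot => // f i Ff.
  exact: (S1even_le hA hB (mF Ff) (FM Ff) r01 C0 dec).
by move=> f i Ff; exact: (S2odd_le hA hB (mF Ff) (FM Ff) r01 C0 dec).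
Qed.

(** The pointwise bound is uniform over [F]. The absolute entries of [b1] are dominated by the
    values of [z] on both partitions because the rows of [PBA] sum to 1. *)
Lemma raked_path_diff_le z (c r : R) N : ER P A B -> 0 < r < 1 -> 0 <= c ->
  \sum_i z \1_(A i) = 0 -> \sum_j z \1_(B j) = 0 ->
  (forall f k i, F f -> `|((cond_mx P B A *m cond_mx P A B) ^+ k *m
     (cexp_vec P B f - cond_mx P B A *m cexp_vec P A f)) i 0| <= c * r ^+ k) ->
  (forall f k i, F f -> `|((cond_mx P B A *m cond_mx P A B) ^+ k *m
     (cexp_vec P B f - const_mx (\int[P]_x f x))) i 0| <= c * r ^+ k) ->
  forall (y yoo : linf R F), (forall f : F, y f = raked P A B N.+1 z (val f)) ->
  (forall f : F, yoo f = raked_limit P A B z (val f)) ->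
  `|y - yoo| <= 2 * c / (1 - r) * r ^+ N./2 *
    (\sum_i `|z \1_(A i)| + \sum_j `|z \1_(B j)|).
Proof.
move=> hER r01 c0 zA zB vr er y yoo yE yooE.
have /andP[r0 r1] := r01.
have k0 : 0 <= 2 * c / (1 - r) * r ^+ N./2.
  by rewrite mulr_ge0 ?divr_ge0 ?mulr_ge0 ?exprn_ge0 ?subr_ge0 ?(ltW r0) ?(ltW r1).
have [rho [C [rho01 C0 dec]]] := ER_geometric hA hB hER.
have b1_le : \sum_j `|raked_once P A B z j 0| <=
    \sum_i `|z \1_(A i)| + \sum_j `|z \1_(B j)|.
  have [PBA0 PBA1] := cond_mx_stochastic hA hB.
  apply: (@le_trans _ _ (\sum_j (`|z \1_(B j)| +
     \sum_i cond_mx P A B i j * `|z \1_(A i)|))).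
    apply: ler_sum => j _; rewrite /raked_once mxE [X in X + _]mxE [X in _ + X]mxE.
    rewrite (le_trans (ler_normB _ _))// lerD2l mxE.
    rewrite (le_trans (ler_norm_sum _ _ _))//; apply: ler_sum => i _.
    by rewrite mxE [eval_vec _ _ _ _]mxE normrM (ger0_norm (PBA0 i j)).
  rewrite big_split /= addrC lerD2r exchange_big /=; apply: ler_sum => i _.
  by rewrite -mulr_suml PBA1 mul1r.
apply: linf_norm_le => [|f].
  by rewrite mulr_ge0// addr_ge0 ?sumr_ge0.
have Ff : F (val f) by exact: set_valP.
rewrite -[(y - yoo) f]/(y f - yoo f) yE yooE.
apply: le_trans (raked_diff_le hA hB (mF Ff) (FM Ff) rho01 C0 dec zA zB _ r01
  (fun k i => vr _ k i Ff) (fun k i => er _ k i Ff)) _.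
by rewrite ler_wpM2l.
Qed.

End raked_paths.

(** * Exceptional events for the bridge *)

Section exceptional_event.
Context {R : realType} {d : measure_display} {T : measurableType d}.
Variable Pr : probability T R.

Lemma measure_bigsetU_ord_le (n : nat) (E : 'I_n -> set T) (b : R) :
  (forall i, measurable (E i)) -> (forall i, (Pr (E i) <= b%:E)%E) ->
  measurable (\big[setU/set0]_i E i) /\
  (Pr (\big[setU/set0]_i E i) <= (n%:R * b)%:E)%E.
Proof.
elim: n E => [|n IH] E mE Eb.
  by rewrite big_ord0 mul0r measure0; split.
have [mU Ub] := IH (fun i => E (widen_ord (leqnSn n) i))
  (fun i => mE _) (fun i => Eb _).
rewrite big_ord_recr /=; split; first exact: measurableU.
apply: le_trans (measureU2 _ _ _) _ => //.
rewrite -natr1 mulrDl mul1r EFinD.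
by apply: leeD; [exact: Ub|exact: Eb].
Qed.

Lemma sub_bigsetU_ord (n : nat) (E : 'I_n -> set T) i :
  E i `<=` \big[setU/set0]_j E j.
Proof. by move=> w Ew; rewrite (bigD1 i)//=; left. Qed.

End exceptional_event.

Section bridge_event.
Context {R : realType} {d d' : measure_display} {X : measurableType d}
  {Omega : measurableType d'}.
Variables (P : probability X R) (Pr : probability Omega R).
Variables (F : set (X -> R)) (G : Omega -> (X -> R) -> R).
Hypothesis hG : brownian_bridge Pr P F G.
Variables (m1 m2 : nat) (A : 'I_m1 -> set X) (B : 'I_m2 -> set X).
Hypotheses (hA : positive_partition P A) (hB : positive_partition P B).
Hypotheses (FA : forall i, F \1_(A i)) (FB : forall j, F \1_(B j)).

Lemma bridge_null_event : exists E : set Omega,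
  [/\ measurable E, Pr E = 0%E & forall w, ~ E w ->
      \sum_i G w \1_(A i) = 0 /\ \sum_j G w \1_(B j) = 0].
Proof.
have [mA A0] := bridge_partition_sum hG hA FA.
have [mB B0] := bridge_partition_sum hG hB FB.
exists ([set w | \sum_i G w \1_(A i) != 0] `|` [set w | \sum_j G w \1_(B j) != 0]).
split; [exact: measurableU|exact: null_set_setU|].
by move=> w /not_orP[/= /negP/negPn/eqP ? /negP/negPn/eqP ?].
Qed.

(** The event joins the null event of nonzero totals to the [m1 + m2] tail events, whose
    probabilities are added. *)
Lemma bridge_event (t : R) : 10 <= t -> exists E : set Omega,
  [/\ measurable E,
      (Pr E <= ((m1 + m2)%:R * (2 * expR (- (t ^+ 2 / 128))))%:E)%E &
      forall w, ~ E w -> [/\ \sum_i G w \1_(A i) = 0, \sum_j G w \1_(B j) = 0 &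
        \sum_i `|G w \1_(A i)| + \sum_j `|G w \1_(B j)| <= (m1 + m2)%:R * t]].
Proof.
move=> t10; have [N [mN N0 NP]] := bridge_null_event.
have tail m (D : 'I_m -> set X) : positive_partition P D ->
    (forall i, F \1_(D i)) -> exists E : set Omega,
    [/\ measurable E, (Pr E <= (m%:R * (2 * expR (- (t ^+ 2 / 128))))%:E)%E &
      forall w, ~ E w -> \sum_i `|G w \1_(D i)| <= m%:R * t].
  move=> hD FD.
  have [mU Ub] := measure_bigsetU_ord_le
    (fun i => measurable_norm_gt t (bridge_measurable hG (FD i)))
    (fun i => bridge_partition_tail hG hD FD i t10).
  eexists; split; [exact: mU|exact: Ub|move=> w nE].
  rewrite mulr_natl -[m in leRHS]card_ord -sumr_const; apply: ler_sum => i _.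
  rewrite leNgt; apply/negP => ti; apply: nE.
  exact: (@sub_bigsetU_ord _ _ _ _ i).
have [EA [mEA PA AP]] := tail _ _ hA FA.
have [EB [mEB PB BP]] := tail _ _ hB FB.
exists (N `|` (EA `|` EB)); split.
- by apply: measurableU => //; exact: measurableU.
- apply: (@le_trans _ _ (Pr N + (Pr EA + Pr EB))%E).
    apply: (@le_trans _ _ (Pr N + Pr (EA `|` EB))%E).
      by apply: measureU2 => //; exact: measurableU.
    by apply: leeD => //; exact: measureU2.
  by rewrite N0 add0e natrD mulrDl EFinD leeD.
move=> w /not_orP[/NP[? ?] /not_orP[/AP ? /BP ?]]; split => //.
by rewrite natrD mulrDl lerD.
Qed.

End bridge_event.

(** * The explicit constant and the final estimate *)

(* The left-hand side is at most [2 * m * l ^+ N], and [l ^+ N] is the square of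
   the rate [l `^ (N / 2)]. *)
Lemma gaussian_tail_rate {R : realType} (K l u : R) (m N : nat) : 1 <= K ->
  0 < l < 1 -> ((2 * m) ^ 2 <= N)%N -> 1 <= u -> 128 * `|ln l| <= u ^+ 2 ->
  m%:R * (2 * expR (- ((Num.sqrt N%:R * u) ^+ 2 / 128))) <=
  K * u * Num.sqrt N%:R * l `^ (N%:R / 2).
Proof.
move=> K1 /andP[l0 l1] mN u1.
rewrite ler0_norm ?ln_le0 ?(ltW l1)// => u2.
set s := l `^ (N%:R / 2); set q := Num.sqrt N%:R.
have s0 : 0 <= s by exact: powR_ge0.
have s1 : s <= 1.
  rewrite /s -[leRHS](powRr0 l); apply: ger_powR; first by rewrite l0 ltW.
  by rewrite divr_ge0.
have ss : expR (- ((q * u) ^+ 2 / 128)) <= s * s.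
  rewrite /s /powR gt_eqF// -expRD ler_expR exprMn sqr_sqrtr// -mulrDl.
  have -> : N%:R / 2 + N%:R / 2 = N%:R :> R by field.
  rewrite -subr_ge0.
  have -> : N%:R * ln l - - (N%:R * u ^+ 2 / 128) =
    N%:R / 128 * (u ^+ 2 - 128 * - ln l) by field.
  by rewrite mulr_ge0 ?divr_ge0// subr_ge0.
have q0 : 0 <= q by exact: sqrtr_ge0.
have q2m : m%:R * 2 <= q.
  rewrite -[leLHS]ger0_norm ?mulr_ge0// -sqrtr_sqr ler_wsqrtr//.
  by rewrite -natrM -natrX ler_nat mulnC.
rewrite mulrA; apply: (@le_trans _ _ (q * (s * s))).
  apply: (@le_trans _ _ (m%:R * 2 * (s * s))).
    by rewrite ler_wpM2l// mulr_ge0.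
  by rewrite ler_wpM2r// mulr_ge0.
apply: (@le_trans _ _ (q * s)).
  by rewrite ler_wpM2l// ler_piMl.
rewrite -mulrA ler_peMl ?mulr_ge0//.
by rewrite -[1]mulr1 ler_pM.
Qed.

(** The first factor dominates the coefficient of the path difference; the second makes the tail
    level high enough for a probability of order [l ^+ N]. The absolute values and the added 1 keep
    it positive for all real arguments. *)
Definition raking_const {R : realType} {m1 m2 : nat} (l1 l2 : R)
    (pA : 'cV[R]_m1) (pB : 'cV[R]_m2) (M : R) : R :=
  let l := Num.max l1 l2 in
  (1 + `|2 * ((\sum_j (pB j 0)^-1) * (2 * M)) / (1 - l) / l * (m1 + m2)%:R|) *
  (1 + Num.sqrt (128 * `|ln l|)).

Lemma raking_const_gt0 {R : realType} {m1 m2 : nat} (l1 l2 : R)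
    (pA : 'cV[R]_m1) (pB : 'cV[R]_m2) (M : R) : 0 < raking_const l1 l2 pA pB M.
Proof. by rewrite mulr_gt0// ltr_wpDr// sqrtr_ge0. Qed.

Theorem theorem2p2 (R : realType) (m1 m2 : nat)
    (hm1 : (2 <= m1)%N) (hm2 : (2 <= m2)%N) :
  exists c3 : R -> R -> 'cV[R]_m1 -> 'cV[R]_m2 -> R -> R,
    (forall l1 l2 pA pB M, 0 < c3 l1 l2 pA pB M) /\
  forall (d : measure_display) (X : measurableType d) (P : probability X R)
    (A : 'I_m1 -> set X) (B : 'I_m2 -> set X)
    (hA : positive_partition P A) (hB : positive_partition P B)
    (hAB : range A <> range B)
    (M : R) (F : set (X -> R)) (hF : admissible_class P A B M F)
    (d' : measure_display) (Omega : measurableType d')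
    (Pr : probability Omega R) (G : Omega -> (X -> R) -> R)
    (hG : brownian_bridge Pr P F G) (hER : ER P A B),
  exists (GN : nat -> Omega -> linf R F) (Ginf : Omega -> linf R F),
    [/\ forall N w (f : F), GN N w f = raked P A B N (G w) (val f),
        forall w (f : F), Ginf w f = raked_limit P A B (G w) (val f),
        {ae Pr, forall w, GN N w @[N --> \oo] --> Ginf w},
        centered_gaussian_process Pr F (fun w => raked_limit P A B (G w)) &
        forall lambda1 lambda2 : R,
          0 < lambda1 < 1 -> 0 < lambda2 < 1 ->
          convergence_rates P A B F lambda1 lambda2 ->
          \forall N \near \oo,
            dLP Pr (GN N) Ginf <=
              c3 lambda1 lambda2 (prob_vec P A) (prob_vec P B) M
              * Num.sqrt N%:R * (Num.max lambda1 lambda2) `^ (N%:R / 2)].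
Proof.
exists raking_const; split; first by move=> *; exact: raking_const_gt0.
move=> d X P A B hA hB _ M F hF d' Omega Pr G hG hER.
have mF := class_measurable hF; have FM := class_bounded hF.
have FA i : F \1_(A i) by have [] := class_stableA hF i.
have FB j : F \1_(B j) by have [] := class_stableB hF j.
have bG := bridge_bounded hG.
pose GN N w := Linf (bounded_path_linf
  (raked_bounded_path hA hB mF FM N (bG w))).
pose Ginf w := Linf (bounded_path_linf
  (raked_limit_bounded_path hA hB mF FM hER (bG w))).
have M0 : 0 <= M.
  (* The bound [M] dominates the absolute value of an indicator at some point, hence is
     nonnegative. *)
  have : F \1_(A (Ordinal (ltnW hm1))) by [].
  move=> /FM/(_ point) ; exact: le_trans.
exists GN, Ginf; split => //.
(* Almost sure convergence: off the null event both totals vanish, and the path difference decays at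
   the ergodic rate [rho]. *)
- have [E [mE E0 EP]] := bridge_null_event hG hA hB FA FB.
  exists E; split => // w; apply: contra_notP => /EP[zA zB].
  have [rho [C [r01 C0 dec]]] := ER_geometric hA hB hER.
  have := @cvg_expr_half R rho (2 * (C * (2 * M)) / (1 - rho) *
    (\sum_i `|G w \1_(A i)| + \sum_j `|G w \1_(B j)|)) r01.
  move=> /cvgr0_norm_le small.
  apply/cvgrPdist_le => e e0; have [N0 _ N0e] := small e e0.
  exists N0.+1 => // -[//|N] N0N; have h := N0e N N0N; rewrite /= distrC.
  have c0 : 0 <= C * (2 * M) by rewrite !mulr_ge0// ltW.
  apply: le_trans (raked_path_diff_le (N := N) (y := GN N.+1 w) (yoo := Ginf w)
    hA hB mF FM hER r01 c0 zA zB
    (fun f k i Ff => dec _ _ (cexp_vec_diff_mean hA hB (mF f Ff) (FM f Ff))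
      (cexp_vec_diff_le hA hB (mF f Ff) (FM f Ff)) k i)
    (fun f k i Ff => dec _ _ (cexp_vec_center_mean hB (mF f Ff) (FM f Ff))
      (cexp_vec_center_le hB (mF f Ff) (FM f Ff)) k i)
    (fun=> erefl) (fun=> erefl)) _.
  by rewrite mulrAC (le_trans (ler_norm _)).
- exact: raked_limit_gaussian hG FA FB.
move=> l1 l2 /andP[l10 l11] /andP[l20 l21] [c1 [c2 [c10 c20 _ [rate_even rate_odd]]]].
pose l := Num.max l1 l2.
have l01 : 0 < l < 1 by rewrite lt_max l10 gt_max l11 l21.
have /andP[l0 l_lt1] := l01.
have [rho [C [r01 C0 dec]]] := ER_geometric hA hB hER.
(* Only the orbits of [TB] have to be controlled; their rate [l2] is weakened to the maximum [l]. *)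
have widen_rate n (Sn : nat -> (X -> R) -> 'cV[R]_n) S :
    geometric_rate F Sn S c2 l2 ->
    forall f, F f -> forall N, `|Sn N f - S f| <= c2 * l ^+ N.
  move=> rate f Ff N; apply: le_trans (rate N f Ff) _.
  rewrite ler_wpM2l ?(ltW c20)// lerXn2r ?nnegrE ?(ltW l0) ?(ltW l20)//.
  by rewrite le_max lexx orbT.
pose kappa := (\sum_j (fine (P (B j)))^-1) * (2 * M).
have kappa0 : 0 <= kappa.
  by rewrite mulr_ge0 ?mulr_ge0// sumr_ge0// => j _; rewrite invr_ge0 fine_ge0.
pose K0 := 2 * kappa / (1 - l) / l * (m1 + m2)%:R.
pose u := 1 + Num.sqrt (128 * `|ln l|).
have constE : raking_const l1 l2 (prob_vec P A) (prob_vec P B) M = (1 + `|K0|) * u.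
  by rewrite /raking_const -/l /K0 /kappa; under eq_bigr do rewrite mxE.
rewrite constE -/l.
(* From 100 on, [sqrt N] is at least 10, as the tail bound requires; the other threshold is that of
   [gaussian_tail_rate]. *)
exists (maxn 100 ((2 * (m1 + m2)) ^ 2)) => // -[|N] /=;
  rewrite geq_max => /andP[N100 Nm] //.
pose q : R := Num.sqrt N.+1%:R.
have q10 : 10 <= q.
  rewrite -[leLHS]ger0_norm// -sqrtr_sqr ler_wsqrtr//.
  by rewrite -natrX ler_nat.
have u1 : 1 <= u by rewrite /u lerDl sqrtr_ge0.
have u2 : 128 * `|ln l| <= u ^+ 2.
  have v0 : 0 <= 128 * `|ln l| by rewrite mulr_ge0.
  rewrite -{1}(sqr_sqrtr v0) lerXn2r ?nnegrE ?sqrtr_ge0//; last by rewrite lerDr.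
  exact: le_trans u1.
have u0 : 0 < u by exact: lt_le_trans u1.
have q0 : 0 < q by exact: lt_le_trans q10.
have t10 : 10 <= q * u by rewrite (le_trans q10)// ler_peMr// (le_trans _ q10).
(* At the level [q * u], of order [sqrt N], both the probability of [E] and the path difference off
   [E] fit under the claimed bound. *)
have [E [mE PE EP]] := bridge_event hG hA hB FA FB t10.
have s0 : 0 < l `^ (N.+1%:R / 2) by exact: powR_gt0.
have K1 : 1 <= 1 + `|K0| by rewrite lerDl.
apply: (dLP_le _ mE).
- by rewrite !mulr_gt0// (lt_le_trans _ K1).
- by apply: le_trans PE _; rewrite lee_fin; exact: gaussian_tail_rate.
move=> w /EP[zA zB S_le].
apply: le_lt_trans (raked_path_diff_le (N := N) (y := GN N.+1 w) (yoo := Ginf w)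
  hA hB mF FM hER l01 kappa0 zA zB
  (fun f k i Ff => cexp_vec_diff_rate hA hB (mF f Ff) (FM f Ff) l0
    (widen_rate _ _ _ rate_odd f Ff) k i)
  (fun f k i Ff => cexp_vec_center_rate hA hB (mF f Ff) (FM f Ff) r01 C0 dec l0
    (widen_rate _ _ _ rate_even f Ff) (widen_rate _ _ _ rate_odd f Ff) k i)
  (fun=> erefl) (fun=> erefl)) _.
set s := l `^ _ in s0 *.
have k0 : 0 <= 2 * kappa / (1 - l).
  by apply: divr_ge0; [exact: mulr_ge0|rewrite subr_ge0 ltW].
apply: (@le_lt_trans _ _ (2 * kappa / (1 - l) * (s / l) * ((m1 + m2)%:R * (q * u)))).
  apply: ler_pM => //.
  - by rewrite mulr_ge0// exprn_ge0// ltW.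
  - by rewrite addr_ge0// sumr_ge0.
  by rewrite ler_wpM2l//; exact: expr_half_le.
have -> : 2 * kappa / (1 - l) * (s / l) * ((m1 + m2)%:R * (q * u)) = K0 * (u * q * s).
  by rewrite /K0; ring.
have -> : (1 + `|K0|) * u * q * s = (1 + `|K0|) * (u * q * s) by rewrite !mulrA.
(* The added 1 makes the comparison strict, as [dLP_le] demands. *)
rewrite ltr_pM2r; last by rewrite !mulr_gt0.
by rewrite (le_lt_trans (ler_norm _))// ltrDr.
Qed.
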